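(* Let $d\ge2$ be an odd square-free integer and put $n_d=\max_{p\mid d}\{f_p\}+2$. Then for all integers $n\ge n_d$, $$\mathrm{ord}_2\big(L(\chi_n\psi_d,-1)\big)=1+2^{1-n}\cdot\Big(-1+\sum_{p\mid d}2^{f_p}\Big).$$
   Context: $\mathbb{Q}_n$ is the $n$-th layer of the cyclotomic $\mathbb{Z}_2$-extension of $\mathbb{Q}$. For $n\ge1$, $\chi_n$ is a primitive character of $\mathrm{Gal}(\mathbb{Q}_n/\mathbb{Q})$ (i.e. one of order $2^n$), viewed as an even primitive Dirichlet character modulo $2^{n+2}$. $\psi_d$ is the Dirichlet character associated to $\mathbb{Q}(\sqrt d)/\mathbb{Q}$. $L(\rho,s)$ is the Dirichlet $L$-function of $\rho$. For an odd prime $p$, $p^*=\left(\frac{-1}{p}\right)p$ and $f_p=\mathrm{ord}_2\left(\frac{p^*-1}{4}\right)$; $p$ ranges over prime divisors of $d$. $\mathrm{ord}_2$ is a fixed $2$-adic valuation on $\overline{\mathbb{Q}}$ with $\mathrm{ord}_2(2)=1$. *)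

(* Defs.v *)
From HB Require Import structures.
From mathcomp Require Import all_boot all_order all_algebra.
From mathcomp Require Import complex.
From mathcomp Require Import all_classical all_reals all_analysis.

Set Implicit Arguments.
Unset Strict Implicit.
Unset Printing Implicit Defensive.

Import Order.TTheory GRing.Theory Num.Theory numFieldNormedType.Exports.

Local Open Scope classical_set_scope.
Local Open Scope complex_scope.
Local Open Scope ring_scope.

Definition squarefree (d : nat) : Prop :=
  forall p, prime p -> ~~ (p ^ 2 %| d)%N.

(** * Dirichlet characters, as functions on the integers *)

Definition dirichlet_character (R : realType) (N : nat) (chi : int -> R[i]) :
    Prop :=
  [/\ forall a, chi (a + N%:Z) = chi a,
      forall a b, chi (a * b) = chi a * chi b &
      forall a, (chi a != 0) = coprimez a N%:Z].

(* The conductor of [chi] is exactly [N]: [chi] is nontrivial on the kernel of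
   (Z/N)^* -> (Z/M)^* for every proper divisor [M] of [N]. *)
Definition primitive_character (R : realType) (N : nat) (chi : int -> R[i]) :
    Prop :=
  forall M : nat, (M %| N)%N -> (M < N)%N ->
    exists a : int, [/\ coprimez a N%:Z, (M%:Z %| a - 1)%Z & chi a != 1].

Definition character_order (R : realType) (N : nat) (chi : int -> R[i])
    (m : nat) : Prop :=
  forall k : nat,
    (forall a : int, coprimez a N%:Z -> chi a ^+ k = 1) <-> (m %| k)%N.

(* [chi] is a primitive character of the Galois group of the [n]-th layer Q_n
   of the cyclotomic Z_2-extension of Q.  Since Q_n is the maximal real subfield
   of the 2^(n+2)-th cyclotomic field, the characters of Gal(Q_n/Q) are the even
   Dirichlet characters modulo 2^(n+2); the primitive ones are those of order
   2^n, whose conductor is 2^(n+2). *)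
Definition cyclotomic_Z2_character (R : realType) (n : nat)
    (chi : int -> R[i]) : Prop :=
  let N := (2 ^ (n + 2))%N in
  [/\ dirichlet_character N chi, chi (- 1) = 1,
      primitive_character N chi & character_order N chi (2 ^ n)].

(** * The quadratic character of Q(sqrt d) *)

(* Legendre symbol (a/p), for an odd prime [p]. *)
Definition legendre (a : int) (p : nat) : int :=
  if (p%:Z %| a)%Z then 0
  else if [exists x : 'I_p, (p%:Z %| (x%:Z ^+ 2 - a))%Z] then 1 else - 1.

(* Kronecker symbol (D/p), for any prime [p]. *)
Definition kronecker_prime (D : int) (p : nat) : int :=
  if p == 2 then
    if (2%:Z %| D)%Z then 0
    else if ((D %% 8)%Z == 1) || ((D %% 8)%Z == 7) then 1 else - 1
  else legendre D p.

(* Kronecker symbol (D/m), for m > 0. *)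
Definition kronecker (D : int) (m : nat) : int :=
  \prod_(p <- primes m) kronecker_prime D p ^+ logn p m.

(* The discriminant of Q(sqrt d), for [d] > 1 square-free. *)
Definition quadratic_disc (d : nat) : nat :=
  if (d %% 4 == 1)%N then d else (4 * d)%N.

Definition psi (d m : nat) : int := kronecker (quadratic_disc d)%:Z m.

Definition pstar (p : nat) : int := legendre (- 1) p * p%:Z.

(* [pstar p] is congruent to 1 modulo 4, so the division is exact. *)
Definition f2 (p : nat) : nat := logn 2 `|((pstar p - 1) %/ 4)%Z|%N.

Definition n_bound (d : nat) : nat := ((\max_(p <- primes d) f2 p) + 2)%N.

(** * Dirichlet L-functions *)

Definition cexp (R : realType) (z : R[i]) : R[i] :=
  (expR (complex.Re z))%:C * (cos (complex.Im z) +i* sin (complex.Im z)).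

(* m ^ (- s) for m > 0 *)
Definition nat_cpowN (R : realType) (m : nat) (s : R[i]) : R[i] :=
  cexp (- s * (ln m%:R)%:C).

Definition analytic_on_C (R : realType) (f : R[i] -> R[i]) : Prop :=
  forall z0 : R[i], exists (c : nat -> R[i]) (r : R), 0 < r /\
    forall z : R[i], `|z - z0| < r%:C ->
      series (fun k => c k * (z - z0) ^+ k : R[i]^o) @ \oo --> (f z : R[i]^o).

(* [L] is the analytic continuation to the whole complex plane of the Dirichlet
   series of [rho] (for [rho] a nonprincipal Dirichlet character, so that there
   is no pole at 1).  By the identity theorem [L] is unique. *)
Definition is_dirichlet_L (R : realType) (rho : nat -> R[i])
    (L : R[i] -> R[i]) : Prop :=
  analytic_on_C L /\
  forall s : R[i], 1 < complex.Re s ->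
    series (fun k => rho k.+1 * nat_cpowN k.+1 s : R[i]^o) @ \oo
      --> (L s : R[i]^o).

(** * The 2-adic valuation on the algebraic numbers in C *)

Definition is_algebraic (R : realType) (z : R[i]) : Prop :=
  algebraicOver (ratr : rat -> R[i]) z.

(* Only the values of [v] on algebraic numbers matter.  The condition v 2 = 1
   forces [v] to restrict to the usual 2-adic valuation on Q. *)
Definition is_ord2 (R : realType) (v : R[i] -> \bar R) : Prop :=
  [/\ forall x, is_algebraic x -> v x != -oo%E /\ (v x = +oo%E <-> x = 0),
      forall x y, is_algebraic x -> is_algebraic y ->
        v (x * y) = (v x + v y)%E,
      forall x y, is_algebraic x -> is_algebraic y ->
        (Order.min (v x) (v y) <= v (x + y)%R)%E &
      v 2 = 1%E].

(* Main.v *)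
Require Import Defs.
From HB Require Import structures.
From mathcomp Require Import all_boot all_order all_algebra.
From mathcomp Require Import fingroup cyclic pgroup finalg finfield.
From mathcomp Require Import complex.
From mathcomp Require Import all_classical all_reals all_analysis.
From mathcomp Require Import finset.
From mathcomp Require Import zify ring lra.

(** Write rho = chi * psi_d, an even function of period f = 2^(n+2) d supported
    on the odd integers.

    The value at -1.  For such a rho one has L(-1) = - (sum_(a < f) rho(a) a^2) / (2 f)
    ([dirichlet_L_value]); this is -B_(2,rho)/2.  The analytic continuation is
    carried out on the real axis only.  In the block of the integers k f + a,
    subtract from (k f + a)^-s the first terms of its Euler-MacLaurin expansion.
    The remainder is O(k^(-s-3)) and it vanishes at s = -1, because the expansion
    is exact on polynomials of degree 1.  Since rho and rho(a) a have sum 0 over a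
    period, the subtracted terms telescope, and at s = -1 only their boundary term
    survives.  The remainders sum normally, as power series, around every point of
    [-1, 2], so the identity theorem for real power series identifies the result
    with the given entire function.

    Periodicity of psi_d.  The Kronecker symbol is given by its values at primes;
    that it has period 4d and is even is quadratic reciprocity, proved here with
    Gauss sums in a finite field of characteristic q ([quadratic_reciprocity]).

    The valuation.  For a set T of prime divisors of d let psi_T be the product of
    the characters of Q(sqrt p), p in T, and let A(T) be the value at -1 for
    chi psi_T.  The claim is that A(T) has the same leading 2-adic term as
    B(T) = A({}) * prod_(p in T) (1 - chi(p)), whose valuation is the one announced:
    chi(p) is a root of unity of order 2^(n - f_p), and A({}) has valuation
    1 - 2^(1-n).  Expand prod_(p in T) (psi_p + 1_p), where 1_p is the indicator of
    the integers prime to p.  Every factor takes even values, so the sum over all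
    subsets U of T of the values at -1 for chi psi_U prod_(p in T \ U) 1_p is
    2^|T| times an element of valuation at least 1 - 2^(1-n).  The term of U is A(U)
    times the Euler factors 1 - chi(p) psi_U(p) p of the p in T \ U; for U <> T it
    has, by induction on |T|, the leading term of B(T).  There are 2^|T| - 1 of
    these terms, and 2^|T| B(T) is negligible, so A(T) has the leading term of B(T)
    as soon as 2^|T| times that element is negligible too.  This holds because
    n >= f_p + 2 makes every 1 - chi(p) of valuation at most 1/2.

    Both facts on valuations used here, the lower bound 1 - 2^(1-n) and the exact
    value for A({}), come from multiplying the residues by a number c prime to f with
    1 - chi(c) c^2 of valuation 2^(1-n) ([fold_identity]): c = 1 + 4d preserves every
    function of period 4d, and c = 3 makes the count for A({}) easy. *)

Set Implicit Arguments.
Unset Strict Implicit.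
Unset Printing Implicit Defensive.

Import Order.TTheory GRing.Theory Num.Theory numFieldNormedType.Exports.

Local Open Scope complex_scope.
Local Open Scope ring_scope.

(** * Quadratic reciprocity *)

Definition quad_char (p : nat) (x : 'F_p) : int :=
  if x == 0 then 0 else if [exists y : 'F_p, y ^+ 2 == x] then 1 else - 1.

Section QuadraticCharacter.
Variable p : nat.
Hypotheses (pp : prime p) (p2 : odd p).

Lemma Fp_intr_eq0 (a : int) : (a%:~R == 0 :> 'F_p) = (p%:Z %| a)%Z.
Proof. by rewrite -(dvdz_pcharf (pchar_Fp pp)). Qed.

Lemma legendreE (a : int) : legendre a p = quad_char (a%:~R : 'F_p).
Proof.
rewrite /legendre /quad_char Fp_intr_eq0; case: ifP => // _.
congr (if _ then _ else _); apply/existsP/existsP => -[x hx].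
  exists x%:R; move: hx; rewrite -Fp_intr_eq0 rmorphB rmorphXn /= subr_eq0.
  by [].
have hxp : (x < p)%N by rewrite -[X in (_ < X)%N](Fp_cast pp); apply: ltn_ord.
exists (Ordinal hxp); rewrite -Fp_intr_eq0 rmorphB rmorphXn /= subr_eq0.
by rewrite -pmulrn natr_Zp.
Qed.

Lemma Fp_expf (x : 'F_p) : x != 0 -> x ^+ p.-1 = 1.
Proof.
move=> x0; have := expf_card x; rewrite card_Fp // => hx.
by apply: (mulfI x0); rewrite -exprS prednK ?prime_gt0 // hx mulr1.
Qed.

Lemma half_predn_mul2 : (p.-1./2 * 2 = p.-1)%N.
Proof. by have := odd_double_half p.-1; have := prime_gt0 pp; lia. Qed.

Lemma Fp_two_neq0 : (2%:R : 'F_p) != 0.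
Proof.
rewrite -(dvdn_pcharf (pchar_Fp pp)); apply/negP => /dvdn_leq.
by have := prime_gt1 pp; lia.
Qed.

(** Euler's criterion.  A nonsquare x with x^((p-1)/2) = 1 would be a root of
    X^((p-1)/2) - 1 besides the (p-1)/2 squares of 1, ..., (p-1)/2. *)
Lemma euler_criterion (x : 'F_p) : (quad_char x)%:~R = x ^+ p.-1./2.
Proof.
have h0 : (0 < p.-1./2)%N by have := prime_gt1 pp; lia.
rewrite /quad_char; case: eqVneq => [->|x0]; first by rewrite expr0n eqn0Ngt h0.
case: ifP => [/existsP[y /eqP yx]|/negbT nsq].
  rewrite -yx in x0 *.
  rewrite -exprM mulnC half_predn_mul2 Fp_expf //.
  by apply: contra_neq x0 => ->; rewrite expr0n.
have : (x ^+ p.-1./2) ^+ 2 == 1 ^+ 2 by rewrite -exprM half_predn_mul2 Fp_expf ?expr1n.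
rewrite eqf_sqr => /orP[/eqP xh|/eqP -> //]; exfalso.
pose s := x :: [seq (i.+1%:R : 'F_p) ^+ 2 | i <- iota 0 p.-1./2].
have : (size s < size ('X^(p.-1./2) - 1 : {poly 'F_p})%R)%N.
  apply: max_poly_roots.
  - by rewrite -size_poly_eq0 size_XnsubC.
  - rewrite /= rootE !hornerE xh subrr eqxx /=.
    apply/allP => y /mapP[i +]; rewrite mem_iota add0n => /andP[_ hi] ->.
    rewrite rootE !hornerE -exprM mulnC half_predn_mul2 Fp_expf ?subrr //.
    rewrite -(dvdn_pcharf (pchar_Fp pp)); apply/negP => /dvdn_leq.
    by have := half_predn_mul2; lia.
  - rewrite /=; apply/andP; split.
      apply/negP => /mapP[i _ hx]; move/negP: nsq; apply; apply/existsP.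
      by exists i.+1%:R; rewrite hx.
    rewrite map_inj_in_uniq ?iota_uniq // => i j; rewrite !mem_iota !add0n => hi hj.
    move/eqP; rewrite eqf_sqr -addr_eq0 -natrD -(dvdn_pcharf (pchar_Fp pp)).
    case/orP=> [|/dvdn_leq]; last first.
      by have := half_predn_mul2; lia.
    wlog ij : i j hi hj / (i <= j)%N.
      by move=> W; case: (leqP i j) => [|/ltnW] ? /eqP ?; [|symmetry]; apply: W => //; apply/eqP.
    rewrite eq_sym -subr_eq0 -natrB ?ltnS // -(dvdn_pcharf (pchar_Fp pp)) => /dvdn_leq.
    by have := half_predn_mul2; lia.
by rewrite size_XnsubC // /= size_map size_iota ltnn.
Qed.

Lemma quad_char_cases (x : 'F_p) : quad_char x \in [:: 0; 1; - 1 : int].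
Proof. by rewrite /quad_char; case: ifP => // _; case: ifP. Qed.

End QuadraticCharacter.

(** Identities between values of quadratic characters can be checked after
    reduction to any field of odd characteristic. *)
Lemma sign_intr_inj (K : fieldType) (a b : int) : 2%:R != 0 :> K ->
  a \in [:: 0; 1; - 1 : int] -> b \in [:: 0; 1; - 1 : int] ->
  a%:~R = b%:~R :> K -> a = b.
Proof.
move=> K2; rewrite !inE => /or3P[] /eqP-> /or3P[] /eqP-> //;
  rewrite ?rmorphN ?rmorph1 ?rmorph0 /= => /eqP.
- by rewrite eq_sym oner_eq0.
- by rewrite eq_sym oppr_eq0 oner_eq0.
- by rewrite oner_eq0.
- by rewrite -addr_eq0 -[1 + 1]/(2%:R) (negPf K2).
- by rewrite oppr_eq0 oner_eq0.
- by rewrite eq_sym -addr_eq0 -[1 + 1]/(2%:R) (negPf K2).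
Qed.

Section QuadraticCharacterMul.
Variable p : nat.
Hypotheses (pp : prime p) (p2 : odd p).

Lemma quad_charM (x y : 'F_p) : quad_char (x * y) = quad_char x * quad_char y.
Proof.
apply: (@sign_intr_inj _ _ _ (Fp_two_neq0 pp p2)); rewrite ?quad_char_cases //.
  have := quad_char_cases x; have := quad_char_cases y.
  by rewrite !inE => /or3P[] /eqP-> /or3P[] /eqP->.
by rewrite rmorphM /= !euler_criterion // exprMn.
Qed.

Lemma quad_char_eq0 (x : 'F_p) : (quad_char x == 0) = (x == 0).
Proof. by rewrite /quad_char; case: ifP => // _; case: ifP. Qed.

Lemma quad_char_sqr (x : 'F_p) : x != 0 -> quad_char x * quad_char x = 1.
Proof. by rewrite /quad_char => /negPf ->; case: ifP. Qed.

Lemma quad_charN1 : quad_char (- 1 : 'F_p) = (- 1) ^+ p.-1./2.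
Proof.
apply: (@sign_intr_inj _ _ _ (Fp_two_neq0 pp p2)); rewrite ?quad_char_cases //.
  by rewrite -signr_odd; case: odd.
by rewrite euler_criterion // rmorphXn /= rmorphN1.
Qed.

Lemma exists_nonsquare : exists x : 'F_p, quad_char x = - 1.
Proof.
apply/not_existsP => hx.
pose s := [seq (i.+1%:R : 'F_p) | i <- iota 0 p.-1].
have : (size s < size ('X^(p.-1./2) - 1 : {poly 'F_p})%R)%N.
  apply: max_poly_roots.
  - by rewrite -size_poly_eq0 size_XnsubC; have := prime_gt1 pp; lia.
  - apply/allP => y /mapP[i +]; rewrite mem_iota add0n => /andP[_ hi] ->.
    rewrite rootE !hornerE -euler_criterion // subr_eq0.
    have := quad_char_cases (i.+1%:R : 'F_p); rewrite !inE quad_char_eq0.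
    have /negPf -> : quad_char (i.+1%:R : 'F_p) != - 1 by apply/eqP; apply: hx.
    rewrite -(dvdn_pcharf (pchar_Fp pp)) orbF => /orP[/dvdn_leq|/eqP-> //].
    by lia.
  - rewrite map_inj_in_uniq ?iota_uniq // => i j; rewrite !mem_iota !add0n => hi hj.
    wlog ij : i j hi hj / (i <= j)%N.
      by move=> W; case: (leqP i j) => [|/ltnW] ? ?; [|symmetry]; apply: W.
    move/eqP; rewrite eq_sym -subr_eq0 -natrB ?ltnS // -(dvdn_pcharf (pchar_Fp pp)) => /dvdn_leq.
    by lia.
rewrite size_XnsubC ?size_map ?size_iota; have := prime_gt1 pp; lia.
Qed.

Lemma sum_quad_char : \sum_(x : 'F_p) quad_char x = 0.
Proof.
have [n hn] := exists_nonsquare.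
have n0 : n != 0 by rewrite -quad_char_eq0 hn.
have : \sum_(x : 'F_p) quad_char x = - \sum_(x : 'F_p) quad_char x.
  rewrite {1}(reindex_inj (mulfI n0)) /= -sumrN.
  by apply: eq_bigr => x _; rewrite quad_charM hn mulN1r.
lia.
Qed.

End QuadraticCharacterMul.

(** The field with q^(p-1) elements will do: by Fermat p divides the order of its
    unit group, and Cauchy's theorem gives an element of order p. *)
Lemma exists_root_of_unity (p q : nat) : prime p -> prime q -> p != q ->
  exists K : fieldType, exists z : K, [/\ q \in [pchar K], z ^+ p = 1 & z != 1].
Proof.
move=> pp qp pq.
have p1 := prime_gt1 pp.
have [|K chK cardK] := PrimePowerField qp (_ : 0 < p.-1)%N; first by lia.
have [|u _ ou] := @Cauchy _ p [set: {unit K}]%G pp.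
  rewrite /= card_finField_unit cardK.
  have q0 := prime_gt0 qp.
  rewrite -subn1 -eqn_mod_dvd ?expn_gt0 ?q0 //.
  rewrite -(totient_prime pp) Euler_exp_totient //.
  by rewrite prime_coprime // dvdn_prime2 // eq_sym.
exists K, (val u); split=> //.
  by rewrite -FinRing.val_unitX -ou expg_order.
apply/eqP => u1; have : u = 1%g by apply: val_inj.
by move=> u1'; move: ou; rewrite u1' order1; lia.
Qed.

Section GaussSum.
Variables (p q : nat) (K : fieldType) (z : K).
Hypotheses (pp : prime p) (p2 : odd p) (qp : prime q) (q2 : odd q).
Hypotheses (pq : p != q) (chK : q \in [pchar K]) (zp : z ^+ p = 1) (z1 : z != 1).

Let Ex (x : 'F_p) : K := z ^+ x.

Lemma zpow_mod (k : nat) : z ^+ (k %% p) = z ^+ k.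
Proof. by rewrite {2}(divn_eq k p) exprD mulnC exprM zp expr1n mul1r. Qed.

Let ExD (x y : 'F_p) : Ex (x + y) = Ex x * Ex y.
Proof.
rewrite /Ex -exprD -[in RHS]zpow_mod /=.
by rewrite [X in z ^+ (_ %% X)]Fp_cast.
Qed.

Let ExX (x : 'F_p) (k : nat) : Ex x ^+ k = Ex (k%:R * x).
Proof.
elim: k => [|k IH]; first by rewrite mul0r /Ex /= !expr0.
by rewrite exprS IH -ExD mulrSr mulrDl mul1r addrC.
Qed.

Let sumEx (c : 'F_p) : \sum_x Ex (x * c) = if c == 0 then p%:R else 0.
Proof.
case: eqVneq => [->|c0].
  under eq_bigr do rewrite mulr0 /Ex expr0.
  by rewrite sumr_const card_Fp.
have -> : \sum_x Ex (x * c) = \sum_x Ex x by rewrite [RHS](reindex_inj (mulIf c0)).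
have : (Ex 1 - 1) * \sum_x Ex x = 0.
  rewrite mulrBl mul1r {1}mulr_sumr.
  rewrite [X in _ - X](reindex_inj (@addrI _ 1)) /=.
  by under eq_bigr do rewrite -ExD; rewrite subrr.
move/eqP; rewrite mulf_eq0 => /orP[|/eqP //].
rewrite subr_eq0 /Ex; have -> : nat_of_ord (1 : 'F_p) = 1%N.
  by have := Fp_cast pp; rewrite /= => ->; rewrite modn_small ?prime_gt1.
by rewrite expr1 (negPf z1).
Qed.

Definition gauss_sum : K := \sum_(x : 'F_p) (quad_char x)%:~R * z ^+ x.

(** Substituting y = x t in the double sum over (x, y) turns the coefficient of t
    into a full character sum over x, which is nonzero only for t = -1 apart from
    the missing term x = 0. *)
Lemma gauss_sum_sqr : gauss_sum ^+ 2 = (quad_char (- 1 : 'F_p) * p%:Z)%:~R.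
Proof.
rewrite expr2 {1}/gauss_sum mulr_suml.
transitivity (\sum_(x : 'F_p) \sum_(t : 'F_p)
    (if x == 0 then 0 else (quad_char t)%:~R * Ex (x * (1 + t)))).
  apply: eq_bigr => x _; case: eqVneq => [->|x0].
    by rewrite /quad_char eqxx !mul0r big1.
  rewrite /gauss_sum mulr_sumr (reindex_inj (mulfI x0)) /=.
  apply: eq_bigr => t _; rewrite -!/(Ex _) mulrDr mulr1 ExD quad_charM //.
  by rewrite mulrACA -rmorphM /= [quad_char x * _]mulrA quad_char_sqr // mul1r.
rewrite exchange_big /=.
transitivity (\sum_(t : 'F_p) (quad_char t)%:~R *
   ((if t == - 1 then p%:R else 0) - 1) : K).
  apply: eq_bigr => t _.
  have -> : (if t == -1 then p%:R else 0 : K) = \sum_x Ex (x * (1 + t)).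
    by rewrite sumEx addrC addr_eq0.
  rewrite (bigD1 (0 : 'F_p)) //= add0r [in RHS](bigD1 (0 : 'F_p)) //.
  have Ex0 : Ex 0 = 1 by rewrite /Ex expr0.
  rewrite mul0r Ex0 addrAC subrr add0r mulr_sumr.
  by apply: eq_bigr => x /negPf ->.
under eq_bigr do rewrite mulrBr mulr1.
rewrite sumrB -rmorph_sum /= sum_quad_char // subr0 (bigD1 (- 1 : 'F_p)) //= eqxx.
rewrite big1 ?addr0 ?rmorphM //= => t /negPf ->; by rewrite mulr0.
Qed.

Let q0 : (q%:R : 'F_p) != 0.
Proof. by rewrite -(dvdn_pcharf (pchar_Fp pp)) dvdn_prime2. Qed.

(** In characteristic q the q-th power is additive, and z^(q x) is the substitution
    x -> q x in the sum. *)
Lemma gauss_sum_frobenius : gauss_sum ^+ q = (quad_char (q%:R : 'F_p))%:~R * gauss_sum.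
Proof.
rewrite -(pFrobenius_autE chK) /gauss_sum rmorph_sum /= mulr_sumr.
rewrite [RHS](reindex_inj (mulfI q0)) /=; apply: eq_bigr => x _.
rewrite pFrobenius_autE exprMn -!/(Ex _) ExX quad_charM // rmorphM /= !mulrA.
rewrite -[X in X * _ * _]rmorphM /= quad_char_sqr // mul1r; congr (_ * _).
rewrite -rmorphXn /=; congr (_%:~R); rewrite /quad_char.
case: ifP => _; last (case: ifP => _); rewrite ?expr1n //.
- by rewrite expr0n eqn0Ngt prime_gt0.
- by rewrite -signr_odd q2.
Qed.

Lemma gauss_reciprocity :
  quad_char (((- 1) ^+ p.-1./2 * p%:Z)%:~R : 'F_q) = quad_char (q%:R : 'F_p).
Proof.
have K2 : 2%:R != 0 :> K.
  rewrite -(dvdn_pcharf chK); apply/negP => /dvdn_leq.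
  by have := prime_gt1 qp; lia.
apply: (@sign_intr_inj K); rewrite ?quad_char_cases //.
have p0 : (p%:R : K) != 0 by rewrite -(dvdn_pcharf chK) dvdn_prime2 // eq_sym.
have g0 : gauss_sum != 0.
  have : gauss_sum ^+ 2 != 0.
    by rewrite gauss_sum_sqr quad_charN1 // rmorphM rmorphXn /= rmorphN1 mulf_neq0 // signr_eq0.
  by apply: contra_neq => ->; rewrite expr0n.
have gq : gauss_sum ^+ q = (gauss_sum ^+ 2) ^+ q.-1./2 * gauss_sum.
  rewrite -exprM -exprSr mulnC half_predn_mul2 // prednK //; exact: prime_gt0.
have := gauss_sum_frobenius; rewrite gq => /(mulIf g0) <-.
rewrite gauss_sum_sqr quad_charN1 //.
set a := (- 1) ^+ p.-1./2 * p%:Z.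
have := euler_criterion qp q2 (a%:~R : 'F_q).
rewrite -rmorphXn /= => /eqP; rewrite -subr_eq0 -rmorphB /= Fp_intr_eq0 //.
rewrite (dvdz_pcharf chK) rmorphB subr_eq0 rmorphXn /= => /eqP -> //.
Qed.

End GaussSum.

(** Compare the two expressions for the q-th power of the Gauss sum: the square
    raised to (q-1)/2, evaluated by Euler's criterion modulo q, and the Frobenius. *)
Theorem quadratic_reciprocity (p q : nat) :
  prime p -> odd p -> prime q -> odd q -> p != q ->
  legendre ((- 1) ^+ p.-1./2 * p%:Z) q = legendre q%:Z p.
Proof.
move=> pp p2 qp q2 pq; rewrite !legendreE //.
have [K [z [chK zp z1]]] := exists_root_of_unity pp qp pq.
exact: gauss_reciprocity chK zp z1.
Qed.

(** * The character of a real quadratic field *)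

Lemma odd_mulz (a b : int) : (a %% 2)%Z = 1 -> (b %% 2)%Z = 1 -> ((a * b) %% 2)%Z = 1.
Proof. by move=> ha hb; rewrite -modzMm ha hb. Qed.

Lemma odd_exprz (a : int) k : (a %% 2)%Z = 1 -> ((a ^+ k) %% 2)%Z = 1.
Proof. by move=> ha; elim: k => // k IH; rewrite exprS odd_mulz. Qed.

Section Legendre.
Variable p : nat.
Hypotheses (pp : prime p) (p2 : odd p).

Lemma legendreM (a b : int) : legendre (a * b) p = legendre a p * legendre b p.
Proof. by rewrite !legendreE // rmorphM quad_charM. Qed.

Lemma legendreX (a : int) k : legendre (a ^+ k) p = legendre a p ^+ k.
Proof.
elim: k => [|k IH]; last by rewrite !exprS legendreM IH.
rewrite !expr0 legendreE // /quad_char oner_eq0.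
by case: existsP => // -[]; exists 1; rewrite expr1n.
Qed.

Lemma legendre_eq (a b : int) : (p%:Z %| a - b)%Z -> legendre a p = legendre b p.
Proof.
by rewrite -Fp_intr_eq0 // rmorphB subr_eq0 !legendreE // => /eqP ->.
Qed.

Lemma legendre_eq0 (a : int) : (legendre a p == 0) = (p%:Z %| a)%Z.
Proof. by rewrite legendreE // quad_char_eq0 Fp_intr_eq0. Qed.

Lemma legendre_sqr (a : int) : ~~ (p%:Z %| a)%Z -> legendre (a ^+ 2) p = 1.
Proof.
move=> ha; rewrite legendreX expr2 legendreE // quad_char_sqr //.
by rewrite Fp_intr_eq0.
Qed.

Lemma legendreN1 : legendre (- 1) p = (- 1) ^+ p.-1./2.
Proof. by rewrite legendreE // rmorphN1 quad_charN1. Qed.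

End Legendre.

Definition sign4 (a : int) : int := if (a %% 4)%Z == 3 then - 1 else 1.

Lemma sign4M (a b : int) : (a %% 2)%Z = 1 -> (b %% 2)%Z = 1 ->
  sign4 (a * b) = sign4 a * sign4 b.
Proof.
move=> ha hb; rewrite /sign4 -modzMm.
have /orP : ((a %% 4)%Z == 1) || ((a %% 4)%Z == 3) by lia.
have /orP : ((b %% 4)%Z == 1) || ((b %% 4)%Z == 3) by lia.
by move=> [] /eqP -> [] /eqP ->.
Qed.

Lemma sign4N (a : int) : (a %% 2)%Z = 1 -> sign4 (- a) = - sign4 a.
Proof. by move=> ha; rewrite /sign4; do 2 case: eqP; lia. Qed.

Lemma sign4_nat (q : nat) : odd q -> sign4 q%:Z = (- 1) ^+ q.-1./2.
Proof.
move=> hq; rewrite /sign4 -signr_odd.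
have : odd q.-1./2 = (q %% 4 == 3)%N by lia.
by move=> ->; case: eqP; case: eqP => //; lia.
Qed.

(** The Kronecker character of Q(sqrt p) on odd integers, in the form in which it is
    visibly periodic: by reciprocity (p/m) = (m/p) (-1)^((p-1)/2 (m-1)/2). *)
Definition psi_prime (p : nat) (a : int) : int := legendre a p * sign4 a ^+ p.-1./2.

Section PsiPrime.
Variable p : nat.
Hypotheses (pp : prime p) (p2 : odd p).

Lemma psi_primeM (a b : int) : (a %% 2)%Z = 1 -> (b %% 2)%Z = 1 ->
  psi_prime p (a * b) = psi_prime p a * psi_prime p b.
Proof. by move=> ha hb; rewrite /psi_prime legendreM // sign4M // exprMn mulrACA. Qed.

(** Passing from a to -a multiplies both factors by (-1)^((p-1)/2) = (-1/p). *)
Lemma psi_primeN (a : int) : (a %% 2)%Z = 1 -> psi_prime p (- a) = psi_prime p a.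
Proof.
move=> ha; rewrite /psi_prime sign4N // -(mulN1r a) -(mulN1r (sign4 a)) legendreM //.
by rewrite legendreN1 // exprMn mulrACA -expr2 sqrr_sign mul1r.
Qed.

Lemma psi_primeD (a k : int) : psi_prime p (a + 4 * p%:Z * k) = psi_prime p a.
Proof.
rewrite /psi_prime; congr (_ * _ ^+ _).
  apply: legendre_eq => //; apply/dvdzP; exists (4 * k); ring.
by rewrite /sign4; congr (if _ == _ then _ else _); lia.
Qed.

Lemma psi_prime_1 : psi_prime p 1 = 1.
Proof.
by rewrite /psi_prime -{1}[1](expr0 (0 : int)) legendreX // expr0 mul1r /sign4 /= expr1n.
Qed.

Lemma psi_prime_eq0 (a : int) : (psi_prime p a == 0) = (p%:Z %| a)%Z.
Proof.
rewrite /psi_prime mulf_eq0 legendre_eq0 // expf_eq0 /sign4.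
by case: ifP; rewrite ?oppr_eq0 oner_eq0 andbF orbF.
Qed.

Lemma psi_prime_val (a : int) : ~~ (p%:Z %| a)%Z -> (psi_prime p a == 1) || (psi_prime p a == - 1).
Proof.
move=> ha; rewrite -eqf_sqr expr1n /psi_prime exprMn -exprM mulnC exprM.
have -> : sign4 a ^+ 2 = 1 by rewrite /sign4; case: ifP.
rewrite expr1n mulr1 expr2 legendreE // quad_char_sqr //.
by rewrite Fp_intr_eq0.
Qed.

Lemma psi_primeX (a : int) k : (a %% 2)%Z = 1 -> psi_prime p (a ^+ k) = psi_prime p a ^+ k.
Proof.
move=> ha; elim: k => [|k IH]; first by rewrite !expr0 psi_prime_1.
by rewrite !exprS psi_primeM ?IH //; apply: odd_exprz.
Qed.

Lemma psi_prime_reciprocity (q : nat) : prime q -> odd q ->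
  psi_prime p q%:Z = legendre p%:Z q.
Proof.
move=> qp q2; have [<-{q qp q2}|pq] := eqVneq p q.
  have -> : legendre p%:Z p = 0 by apply/eqP; rewrite legendre_eq0 //.
  by apply/eqP; rewrite psi_prime_eq0.
rewrite /psi_prime -(quadratic_reciprocity pp p2 qp q2 pq) legendreM // legendreX //.
rewrite legendreN1 // sign4_nat // mulrAC -exprMn -expr2 sqrr_sign.
by rewrite expr1n mul1r.
Qed.

(** The sign in p^* is the one making it 1 modulo 4, so the quotient by 4 in the
    definition of f_p is exact and u is the odd part of (p^* - 1)/4. *)
Lemma pstar_decomp : exists2 u : int, (u %% 2)%Z = 1 & pstar p = 1 + 4 * 2 ^+ f2 p * u.
Proof.
have e : pstar p = 1 + 4 * ((pstar p - 1) %/ 4)%Z.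
  rewrite /pstar legendreN1 // -signr_odd.
  have : odd p.-1./2 = (p %% 4 == 3)%N by lia.
  by move=> ->; case: eqP => hp; rewrite ?expr1 ?expr0; lia.
set w := ((pstar p - 1) %/ 4)%Z in e.
have w0 : (0 < `|w|)%N.
  rewrite absz_gt0; apply/eqP => w0; move: e; rewrite w0 mulr0 addr0 /pstar.
  rewrite legendreN1 // -signr_odd; have := prime_gt1 pp.
  by case: odd; rewrite ?expr1 ?expr0; lia.
have := pfactor_coprime (isT : prime 2) w0.
case=> m hm hw; exists (sgz w * m%:Z).
  have : sgz w = 1 \/ sgz w = - 1 by case: sgzP w0 => //; [lia|left|right].
  rewrite coprime2n in hm.
  by case=> ->; lia.
rewrite {1}e; congr (_ + _); rewrite -mulrA; congr (_ * _).
rewrite {1}(intEsg w) hw PoszM mulrA mulrC /f2 -/w; congr (_ * _).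
by rewrite -[LHS]natz natrX.
Qed.

End PsiPrime.

Lemma prod_primes (m : nat) : (0 < m)%N -> m = (\prod_(q <- primes m) q ^ logn q m)%N.
Proof. by move=> m0; rewrite {1}[m]prod_prime_decomp // prime_decompE big_map. Qed.

Lemma odd_prime_dvd (m q : nat) : odd m -> q \in primes m -> prime q /\ odd q.
Proof.
move=> m2; rewrite mem_primes => /and3P[qp _ /dvdnP[k gM]]; split=> //.
by move: m2; rewrite gM oddM => /andP[].
Qed.

Lemma psi_prime_prod (p : nat) (s : seq nat) (e : nat -> nat) : prime p -> odd p ->
  {in s, forall q, odd q} ->
  psi_prime p (\prod_(q <- s) q ^ e q)%N%:Z = \prod_(q <- s) psi_prime p q%:Z ^+ e q
  /\ odd (\prod_(q <- s) q ^ e q)%N.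
Proof.
move=> pp p2; elim: s => [|q s IH] hs; first by rewrite !big_nil psi_prime_1.
have [|IH1 IH2] := IH; first by move=> r hr; apply: hs; rewrite inE hr orbT.
have q2 : odd q by apply: hs; rewrite mem_head.
have q2' : odd (q ^ e q) by rewrite oddX q2 orbT.
rewrite !big_cons oddM q2' IH2 PoszM psi_primeM ?IH1 //; try lia.
split=> //; congr (_ * _); rewrite -psi_primeX //; last by lia.
by rewrite -[in LHS]natz natrX natz.
Qed.

Lemma legendre_prod (q : nat) (s : seq nat) : prime q -> odd q ->
  legendre (\prod_(p <- s) p)%N%:Z q = \prod_(p <- s) legendre p%:Z q.
Proof.
move=> qp q2; elim: s => [|p s IH].
  by rewrite !big_nil -[1%N%:Z](expr0 (0 : int)) legendreX.
by rewrite !big_cons PoszM legendreM // IH.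
Qed.

Lemma squarefree_prod (d : nat) : (0 < d)%N -> Defs.squarefree d ->
  d = (\prod_(p <- primes d) p)%N.
Proof.
move=> d0 sf; rewrite {1}[d]prod_primes //.
rewrite !big_seq; apply: eq_bigr => p hp.
suff -> : logn p d = 1%N by [].
have pp : prime p by move: hp; rewrite mem_primes => /andP[].
have := sf p pp; rewrite pfactor_dvdn // => h1.
by move: hp; rewrite -logn_gt0; lia.
Qed.

(** Both sides are multiplicative in m and in d, so the identity reduces to prime
    arguments, where it is reciprocity; the factor 4 in the discriminant is a square. *)
Lemma psiE (d m : nat) : (0 < d)%N -> odd d -> Defs.squarefree d ->
  (0 < m)%N -> odd m -> psi d m = \prod_(p <- primes d) psi_prime p m%:Z.
Proof.
move=> d0 d2 sf m0 m2; rewrite /psi /kronecker.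
transitivity (\prod_(q <- primes m) \prod_(p <- primes d) psi_prime p q%:Z ^+ logn q m).
  rewrite [LHS]big_seq [RHS]big_seq; apply: eq_bigr => q hq.
  have [qp q2] := odd_prime_dvd m2 hq.
  rewrite prodrXl; congr (_ ^+ _).
  rewrite /kronecker_prime; have -> : (q == 2) = false by lia.
  transitivity (legendre d%:Z q).
    rewrite /quadratic_disc; case: ifP => // _; rewrite PoszM legendreM //.
    rewrite (_ : 4%N%:Z = 2%:Z ^+ 2) // legendre_sqr ?mul1r //.
    by have := prime_gt1 qp; move=> q1; apply/negP => /dvdn_leq; lia.
  rewrite {1}(squarefree_prod d0 sf) legendre_prod //.
  rewrite [LHS]big_seq [RHS]big_seq; apply: eq_bigr => p hp.
  by have [pp p2] := odd_prime_dvd d2 hp; rewrite psi_prime_reciprocity.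
rewrite exchange_big /= [LHS]big_seq [RHS]big_seq; apply: eq_bigr => p hp.
have [pp p2] := odd_prime_dvd d2 hp.
rewrite [in RHS](prod_primes m0); symmetry; apply: (psi_prime_prod _ pp p2 _).1 => q hq.
by have [] := odd_prime_dvd m2 hq.
Qed.

(** * Convergent sums and real power series *)

Section Sums.
Local Open Scope classical_set_scope.
Local Open Scope ring_scope.
Variable R : realType.
Implicit Types (a b : nat -> R) (l m : R).

Definition sums a l := (fun n => \sum_(j < n) a j) @ \oo --> l.

Lemma sumsE a l : (series a @ \oo --> l) = sums a l.
Proof. by rewrite /sums seriesEord. Qed.

Lemma sumsD a b l m : sums a l -> sums b m -> sums (fun j => a j + b j) (l + m).
Proof.
move=> ha hb; rewrite /sums; under eq_fun do rewrite big_split /=; exact: cvgD.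
Qed.

Lemma sumsZ k a l : sums a l -> sums (fun j => k * a j) (k * l).
Proof.
by move=> ha; rewrite /sums; under eq_fun do rewrite -mulr_sumr; apply: cvgMl_tmp.
Qed.

Lemma sums_unique a l m : sums a l -> sums a m -> l = m.
Proof. move=> h1 h2; exact: (cvg_unique _ h1 h2). Qed.

Lemma sums0 : sums (fun=> 0) 0.
Proof. by rewrite /sums; under eq_fun do rewrite big1 //; exact: cvg_cst. Qed.

Lemma sums_bigsum (I : Type) (s : seq I) (P : pred I) (A : I -> nat -> R) (L : I -> R) :
  (forall i, P i -> sums (A i) (L i)) ->
  sums (fun j => \sum_(i <- s | P i) A i j) (\sum_(i <- s | P i) L i).
Proof.
move=> h; elim: s => [|i s IH].
  by rewrite big_nil; under eq_fun do rewrite big_nil; exact: sums0.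
rewrite big_cons; under eq_fun do rewrite big_cons; case: ifP => // Pi.
exact: (sumsD (h i Pi) IH).
Qed.

Lemma lim_le_bound (u : nat -> R) l B : (forall n, `|u n| <= B) -> u @ \oo --> l -> `|l| <= B.
Proof.
move=> hB /cvg_norm hl; apply: (cvgr_to_le hl).
by apply: nearW => n; apply: hB.
Qed.

Lemma sums_le_bound a l B : (forall n, `|\sum_(j < n) a j| <= B) -> sums a l -> `|l| <= B.
Proof. exact: lim_le_bound. Qed.

Lemma sums_abs a M : (forall n, \sum_(j < n) `|a j| <= M) -> exists l, sums a l.
Proof.
move=> hM; have : cvgn (series a).
  apply: normed_cvg; apply: nondecreasing_is_cvgn.
    by apply: nondecreasing_series => n _ _; rewrite /= normr_ge0.
  by exists M => _ [n _ <-]; apply: le_trans (hM n); rewrite -(big_mkord xpredT (fun j => `|a j|)).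
by move=> /cvg_ex[l hl]; exists l; rewrite -sumsE.
Qed.

Lemma sums_tail a l n : sums a l -> sums (fun j => a (n + j)%N) (l - \sum_(j < n) a j).
Proof.
move=> ha; rewrite /sums.
rewrite (_ : (fun _ => _) = (fun k => \sum_(j < k + n) a j - \sum_(j < n) a j)); last first.
  by apply/funext => k; rewrite addnC big_split_ord /= addrAC subrr add0r.
apply: cvgB; last exact: cvg_cst.
by rewrite (cvg_shiftn n (fun k => \sum_(j < k) a j)).
Qed.

Lemma sums_ge0_le a l : (forall j, 0 <= a j) -> sums a l -> forall n, \sum_(j < n) a j <= l.
Proof.
move=> a0 ha n; have ht := sums_tail (n := n) ha.
rewrite -subr_ge0; apply: (cvgr_to_ge ht); apply: nearW => k; exact: sumr_ge0.
Qed.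

Lemma sums_exp x : sums (fun j => x ^+ j / j`!%:R) (expR x).
Proof. by rewrite -sumsE; exact: is_cvg_series_exp_coeff. Qed.

Lemma cvg_zero_bound (u : nat -> R) l q B : 0 <= q < 1 ->
  (forall n, `|l - u n| <= q ^+ n * B) -> u @ \oo --> l.
Proof.
move=> /andP[q0 q1] h; apply/cvgrPdist_le => e e0.
have : (fun n => q ^+ n * B) @ \oo --> (0 * B : R).
  by apply: cvgMr_tmp; apply: cvg_expr; rewrite ger0_norm.
rewrite mul0r => /cvgr0_norm_le /(_ _ e0) hn.
near=> n; apply: le_trans (h n) _; apply: le_trans (ler_norm _) _.
near: n; exact: hn.
Unshelve. all: by end_near. Qed.

End Sums.

Section PowerSeries.
Local Open Scope classical_set_scope.
Local Open Scope ring_scope.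
Variable R : realType.
Implicit Types (F G : R -> R) (s r M : R).

(** The weighted l1 norm of the coefficients is kept as a parameter M because it
    controls F on the whole ball and adds up under infinite sums; it replaces the
    Cauchy estimates of complex analysis. *)
Definition power_series s r M F := exists c : nat -> R,
  (forall n, \sum_(j < n) `|c j| * r ^+ j <= M) /\
  (forall t, `|t| < r -> sums (fun j => c j * t ^+ j) (F (s + t))).

Lemma power_series_ext s r M F G : (forall t, `|t| < r -> F (s + t) = G (s + t)) ->
  power_series s r M F -> power_series s r M G.
Proof. by move=> e [c [h1 h2]]; exists c; split=> // t ht; rewrite -e //; apply: h2. Qed.

Lemma power_series_le s r M M' F : M <= M' -> power_series s r M F -> power_series s r M' F.
Proof. by move=> hM [c [h1 h2]]; exists c; split=> // n; apply: le_trans hM. Qed.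

Lemma power_seriesD s r M M' F G : 0 <= r -> power_series s r M F -> power_series s r M' G ->
  power_series s r (M + M') (fun x => F x + G x).
Proof.
move=> r0 [c [h1 h2]] [c' [h1' h2']]; exists (fun j => c j + c' j); split=> [n|t ht].
  apply: (le_trans _ (lerD (h1 n) (h1' n))); rewrite -big_split /=.
  by apply: ler_sum => j _; rewrite -mulrDl ler_wpM2r ?exprn_ge0 // ler_normD.
have := sumsD (h2 t ht) (h2' t ht); congr sums.
by apply/funext => j; rewrite mulrDl.
Qed.

Lemma power_seriesZ s r M k F : power_series s r M F ->
  power_series s r (`|k| * M) (fun x => k * F x).
Proof.
move=> [c [h1 h2]]; exists (fun j => k * c j); split=> [n|t ht].
  under eq_bigr do rewrite normrM -mulrA.
  by rewrite -mulr_sumr ler_wpM2l.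
by have := sumsZ (k := k) (h2 t ht); congr sums; apply/funext => j; rewrite mulrA.
Qed.

Lemma power_series0 s r : power_series s r 0 (fun=> 0).
Proof.
exists (fun=> 0); split=> [n|t ht]; first by rewrite big1 // => j _; rewrite normr0 mul0r.
by under eq_fun do rewrite mul0r; exact: sums0.
Qed.

Lemma power_series_bigsum s r (I : Type) (q : seq I) (P : pred I) (F : I -> R -> R) (M : I -> R) :
  0 <= r -> (forall i, P i -> power_series s r (M i) (F i)) ->
  power_series s r (\sum_(i <- q | P i) M i) (fun x => \sum_(i <- q | P i) F i x).
Proof.
move=> r0 h; elim: q => [|i q IH].
  rewrite big_nil; apply: power_series_ext (power_series0 s r) => t _; by rewrite big_nil.
rewrite big_cons; case: ifP => Pi; last first.
  by apply: power_series_ext IH => t _; rewrite big_cons Pi.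
apply: power_series_ext (power_seriesD r0 (h i Pi) IH) => t _; by rewrite big_cons Pi.
Qed.

(** Writing x = s + t, multiplication by s scales the coefficients and multiplication
    by t shifts them. *)
Lemma power_series_mulX s r M F : 0 <= r -> power_series s r M F ->
  power_series s r ((`|s| + r) * M) (fun x => x * F x).
Proof.
move=> r0 [c [h1 h2]].
pose c' j := if j is j'.+1 then s * c j + c j' else s * c 0%N.
have M0 : 0 <= M by have := h1 0%N; rewrite big_ord0.
exists c'; split=> [n|t ht].
  case: n => [|n]; first by rewrite big_ord0 mulr_ge0 // addr_ge0.
  rewrite big_ord_recl /= expr0 mulr1 normrM.
  apply: (@le_trans _ _ (`|s| * (`|c 0%N| * r ^+ 0 + \sum_(j < n) `|c j.+1| * r ^+ j.+1) +
      r * \sum_(j < n) `|c j| * r ^+ j)).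
    rewrite mulrDr expr0 mulr1 -addrA lerD2l !mulr_sumr -big_split /=.
    apply: ler_sum => j _; rewrite /bump add1n.
    have -> : `|s| * (`|c j.+1| * r ^+ j.+1) + r * (`|c j| * r ^+ j) =
       (`|s| * `|c j.+1| + `|c j|) * r ^+ j.+1 by rewrite exprS; ring.
    by rewrite ler_wpM2r ?exprn_ge0 // -normrM ler_normD.
  rewrite mulrDl lerD ?ler_wpM2l //.
  by have := h1 n.+1; rewrite big_ord_recl.
have hF := h2 t ht.
(* the shifted series, extended by 0 at the index 0 *)
have : sums (fun j => s * (c j * t ^+ j) + (if j is j'.+1 then t * (c j' * t ^+ j') else 0))
     (s * F (s + t) + t * F (s + t)).
  apply: sumsD; first exact: sumsZ.
  have := sumsZ (k := t) hF; rewrite /sums => h3.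
  rewrite -(cvg_shiftn 1) /=.
  rewrite (_ : (fun _ => _) = (fun n => \sum_(j < n) t * (c j * t ^+ j))) //.
  by apply/funext => n; rewrite addn1 big_ord_recl add0r.
rewrite -mulrDl; congr sums; apply/funext => -[|j] /=; first by rewrite addr0; ring.
rewrite exprS; ring.
Qed.

Lemma power_series_exp s r k : 0 <= r ->
  power_series s r (expR (- k * s + `|k| * r)) (fun x => expR (- k * x)).
Proof.
move=> r0; exists (fun j => expR (- k * s) * ((- k) ^+ j / j`!%:R)); split=> [n|t ht].
  rewrite expRD; under eq_bigr do rewrite normrM (ger0_norm (expR_ge0 _)) -mulrA.
  rewrite -mulr_sumr ler_wpM2l ?expR_ge0 //.
  have pos j : 0 <= (`|k| * r) ^+ j / j`!%:R by rewrite divr_ge0 // exprn_ge0 // mulr_ge0.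
  apply: le_trans (sums_ge0_le pos (@sums_exp R (`|k| * r)) n).
  apply: ler_sum => j _; rewrite normrM normrX normrN (ger0_norm (x := _^-1)) ?invr_ge0 //.
  by rewrite exprMn mulrAC.
have := sumsZ (k := expR (- k * s)) (@sums_exp R (- k * t)); rewrite -expRD -mulrDr.
by congr sums; apply/funext => j; rewrite exprMn; ring.
Qed.

(** Truncating every F_i at order J costs at most (|t|/r)^J M_i, uniformly in i, so
    the limits in i and J can be exchanged. *)
Lemma power_series_sum s r (M_ : nat -> R) M (F_ : nat -> R -> R) F : 0 < r ->
  (forall i, power_series s r (M_ i) (F_ i)) -> (forall n, \sum_(i < n) M_ i <= M) ->
  (forall t, `|t| < r -> sums (fun i => F_ i (s + t)) (F (s + t))) ->
  power_series s r M F.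
Proof.
move=> r0 hF hM hs.
have [c hc] := choice hF.
have rj j : 0 < r ^+ j by rewrite exprn_gt0.
have cM i j : `|c i j| * r ^+ j <= M_ i.
  have [/(_ j.+1)] := hc i; rewrite big_ord_recr /= => h _; apply: le_trans h.
  by rewrite lerDr; apply: sumr_ge0 => k _; rewrite mulr_ge0 // ltW.
have hC j : exists l, sums (fun i => c i j) l.
  apply: (@sums_abs _ _ (M / r ^+ j)) => n; rewrite ler_pdivlMr // mulr_suml.
  by apply: le_trans (hM n); apply: ler_sum => i _.
have [C hCs] := choice hC.
exists C; split=> [n|t ht].
  have : sums (fun i => \sum_(j < n) Num.sg (C j) * r ^+ j * c i j) (\sum_(j < n) `|C j| * r ^+ j).
    have -> : \sum_(j < n) `|C j| * r ^+ j = \sum_(j < n) Num.sg (C j) * r ^+ j * C j.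
      by apply: eq_bigr => j _; rewrite normrEsg mulrAC.
    by apply: sums_bigsum => j _; apply: sumsZ.
  move/sums_le_bound => /(_ M) h; apply: le_trans (ler_norm _) (h _) => k.
  apply: le_trans (ler_norm_sum _ _ _) _; apply: le_trans (hM k); apply: ler_sum => i _.
  apply: le_trans (ler_norm_sum _ _ _) _; have [/(_ n) h1 _] := hc i.
  apply: le_trans h1; apply: ler_sum => j _.
  rewrite !normrM (ger0_norm (ltW (rj j))) mulrC ler_wpM2l //.
  by rewrite -[leRHS]mul1r ler_wpM2r ?(ltW (rj j)) // normr_sg; case: eqP.
pose q := `|t| / r.
have q1 : 0 <= q < 1.
  by apply/andP; split; [rewrite divr_ge0 ?(ltW r0) | rewrite ltr_pdivrMr ?mul1r].
have tq : `|t| = q * r by rewrite /q divfK // gt_eqF.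
apply: (@cvg_zero_bound _ _ _ q M) => // J.
have hJ : sums (fun i => F_ i (s + t) + - 1 * \sum_(j < J) c i j * t ^+ j)
    (F (s + t) - \sum_(j < J) C j * t ^+ j).
  have h2 : sums (fun i => \sum_(j < J) c i j * t ^+ j) (\sum_(j < J) C j * t ^+ j).
    apply: sums_bigsum => j _; rewrite mulrC.
    by under eq_fun do rewrite mulrC; apply: (sumsZ (k := t ^+ j) (hCs j)).
  by have := sumsD (hs t ht) (sumsZ (k := - 1) h2); rewrite [X in F _ + X]mulN1r.
apply: sums_le_bound hJ => k; apply: le_trans (ler_norm_sum _ _ _) _.
apply: (@le_trans _ _ (\sum_(i < k) q ^+ J * M_ i)); last first.
  by rewrite -mulr_sumr ler_wpM2l // exprn_ge0 //; case/andP: q1.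
apply: ler_sum => i _; have [h1 h2] := hc i; rewrite mulN1r.
have ht' := sums_tail (n := J) (h2 t ht).
apply: sums_le_bound ht' => n.
apply: le_trans (ler_norm_sum _ _ _) _.
apply: (@le_trans _ _ (q ^+ J * \sum_(j < n) `|c i (J + j)%N| * r ^+ (J + j))).
  rewrite mulr_sumr; apply: ler_sum => j _; rewrite normrM normrX tq exprMn mulrCA.
  rewrite ler_wpM2r ?mulr_ge0 ?(ltW (rj _)) //.
  case/andP: q1 => q0 q1; rewrite exprD ler_piMr ?exprn_ge0 // exprn_ile1 // ltW //.
case/andP: q1 => q0 q1; rewrite ler_wpM2l ?exprn_ge0 //.
apply: le_trans (h1 (J + n)%N); rewrite big_split_ord /= lerDr.
by apply: sumr_ge0 => j _; rewrite mulr_ge0 // ltW.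
Qed.

End PowerSeries.

(** * The identity theorem on the real line *)

Section IdentityTheorem.
Local Open Scope classical_set_scope.
Local Open Scope ring_scope.
Variable R : realType.
Implicit Types (F G : R -> R) (s r M : R).

Definition analytic_at s F := exists (c : nat -> R) r, 0 < r /\
  forall t, `|t| < r -> sums (fun j => c j * t ^+ j) (F (s + t)).

Lemma power_series_analytic s r M F : 0 < r -> power_series s r M F -> analytic_at s F.
Proof. by move=> r0 [c [_ h]]; exists c, r. Qed.

Lemma analytic_atB s F G : analytic_at s F -> analytic_at s G ->
  analytic_at s (fun x => F x - G x).
Proof.
move=> [c [r [r0 h]]] [c' [r' [r0' h']]].
exists (fun j => c j - c' j), (Num.min r r'); split; first by rewrite lt_min r0.
move=> t; rewrite lt_min => /andP[tr tr'].
have := sumsD (h t tr) (sumsZ (k := - 1) (h' t tr')); rewrite [X in _ + X]mulN1r.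
by congr sums; apply/funext => j; ring.
Qed.

Lemma geometric_half_le (q : R) n : 0 <= q <= 2^-1 -> \sum_(j < n) q ^+ j <= 2.
Proof.
move=> /andP[q0 q1]; elim: n => [|n IH]; first by rewrite big_ord0.
rewrite big_ord_recl expr0 /=; under eq_bigr do rewrite /bump add1n exprS.
rewrite -mulr_sumr; have : q * \sum_(i < n) q ^+ i <= 2^-1 * 2.
  by apply: ler_pM => //; apply: sumr_ge0 => i _; rewrite exprn_ge0.
by lra.
Qed.

(** If c_J is the first nonzero coefficient, the tail beyond J is O(t^(J+1)) and
    cannot cancel c_J t^J for small t. *)
Lemma power_series_coef0 (c : nat -> R) r : 0 < r ->
  (forall t, 0 < t < r -> sums (fun j => c j * t ^+ j) 0) -> forall j, c j = 0.
Proof.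
move=> r0 h; pose u := r / 2.
have u0 : 0 < u by rewrite /u divr_gt0.
have ur : u < r by rewrite /u; lra.
have [B hB] : exists B, forall j, `|c j| * u ^+ j <= B.
  have hu : sums (fun j => c j * u ^+ j) 0 by apply: h; rewrite u0 ur.
  have : cvgn (series (fun j => c j * u ^+ j)) by apply/cvg_ex; exists 0; rewrite sumsE.
  move/cvg_series_bounded => /pinfty_ex_gt0[B _ /= hB].
  exists B => j; have := hB j I; rewrite normrM normrX (ger0_norm (ltW u0)).
  by [].
elim/ltn_ind => J IH; apply/eqP; rewrite -normr_le0 leNgt; apply/negP => cJ.
have e0 : 0 < `|c J| * u ^+ J by rewrite mulr_gt0 ?exprn_gt0.
set e := `|c J| * u ^+ J in e0.
have B0 : 0 < B by apply: lt_le_trans e0 (hB J).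
(* small enough for the bound 2 B q of the tail to stay below e *)
pose q := e / (4 * B).
have q0 : 0 < q by rewrite /q divr_gt0 // mulr_gt0.
have q1 : q <= 2^-1.
  rewrite /q ler_pdivrMr ?mulr_gt0 //; have := hB J; rewrite -/e; lra.
have qB : 2 * B * q < e.
  have -> : 2 * B * q = e / 2 by rewrite /q; field; rewrite gt_eqF.
  lra.
suff : e <= 2 * B * q by rewrite leNgt qB.
pose t := q * u.
have t0 : 0 < t by rewrite mulr_gt0.
have tr : t < r by apply: lt_trans ur; rewrite /t gtr_pMl //; lra.
have ht : sums (fun j => c j * t ^+ j) 0 by apply: h; rewrite t0 tr.
have hT := sums_tail (n := J.+1) ht.
rewrite big_ord_recr /= big1 ?sub0r ?add0r in hT; last first.
  by move=> i _; rewrite IH ?mul0r.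
have : `|- (c J * t ^+ J)| <= q ^+ J * (2 * B * q).
  apply: sums_le_bound hT => n; apply: le_trans (ler_norm_sum _ _ _) _.
  apply: (@le_trans _ _ (\sum_(j < n) (B * q ^+ J.+1) * q ^+ j)).
    apply: ler_sum => j _; rewrite normrM normrX (ger0_norm (ltW t0)) /t exprMn.
    rewrite -mulrA -exprD mulrCA [leRHS]mulrC ler_wpM2l ?exprn_ge0 ?(ltW q0) //.
  rewrite -mulr_sumr exprS; have := @geometric_half_le q n; rewrite (ltW q0) q1 => /(_ isT) hg.
  have -> : q ^+ J * (2 * B * q) = (B * (q * q ^+ J)) * 2 by ring.
  by rewrite ler_wpM2l // mulr_ge0 ?(ltW B0) // mulr_ge0 ?exprn_ge0 ?ltW.
rewrite normrN normrM normrX (ger0_norm (ltW t0)) /t exprMn mulrCA.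
by rewrite ler_pM2l ?exprn_gt0.
Qed.

(** Let m be the infimum of the points beyond which F vanishes.  The power series at
    m vanishes to the right of m, hence identically, so F vanishes to the left of m
    too; this contradicts the choice of m unless m = a. *)
Theorem identity_theorem (a b : R) F : a < b ->
  (forall s, a <= s <= b -> analytic_at s F) ->
  (exists2 x, a <= x < b & forall y, x < y <= b -> F y = 0) -> F a = 0.
Proof.
move=> ab an [x0 hx0 Fx0].
pose S : set R := [set x | a <= x <= b /\ forall y, x < y <= b -> F y = 0].
have Sx0 : S x0 by split=> //; case/andP: hx0 => -> /ltW ->.
have Sa : has_inf S.
  by split; [exists x0 | exists a => x [/andP[]]].
pose m := inf S.
have am : a <= m by apply: lb_le_inf Sa.1 _ => x [/andP[]].
have mb : m < b by apply: le_lt_trans (ge_inf Sa.2 Sx0) _; case/andP: hx0.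
have Fm y : m < y <= b -> F y = 0.
  move=> /andP[my yb].
  have ym : 0 < y - m by rewrite subr_gt0.
  have [x Sx xy] := inf_adherent ym Sa.
  by rewrite addrC subrK in xy; case: Sx => _; apply; rewrite xy.
have [|c [r [r0 hc]]] := an m; first by rewrite am ltW.
pose r' := Num.min r (b - m).
have r'0 : 0 < r' by rewrite lt_min r0 subr_gt0.
have c0 : forall j, c j = 0.
  apply: (power_series_coef0 r'0) => t /andP[t0].
  rewrite lt_min => /andP[tr tb]; rewrite -(Fm (m + t)).
    by apply: hc; rewrite ger0_norm // ltW.
  by rewrite ltrDl t0 /=; lra.
have Fl t : `|t| < r -> F (m + t) = 0.
  move=> tr; apply: sums_unique (hc t tr) _.
  rewrite (_ : (fun _ => _) = fun=> 0); first exact: sums0.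
  by apply/funext => j; rewrite c0 mul0r.
move: am; rewrite le_eqVlt => /orP[/eqP e|am]; first by rewrite e -[m]addr0 Fl // normr0.
pose e := Num.min (r / 2) (m - a).
have e0 : 0 < e by rewrite lt_min divr_gt0 //= subr_gt0.
have : S (m - e).
  split; first by rewrite lerBrDr -lerBrDl ge_min lexx orbT /=; lra.
  move=> y /andP[y1 y2]; have [ym|ym] := ltrP m y; first by apply: Fm; rewrite ym.
  have -> : y = m + (y - m) by ring.
  apply: Fl; have : e <= r / 2 by rewrite ge_min lexx.
  rewrite ler0_norm; lra.
by move/(ge_inf Sa.2); rewrite -/m; lra.
Qed.

End IdentityTheorem.

(** * Remainders in the Euler-MacLaurin expansion of a power *)

Section Remainder.
Local Open Scope classical_set_scope.
Local Open Scope ring_scope.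
Variable R : realType.
Implicit Types (s r M u w z y L : R).

Lemma power_series_norm s r M (F : R -> R) t :
  power_series s r M F -> `|t| < r -> `|F (s + t)| <= M.
Proof.
move=> [c [h1 h2]] tr; apply: sums_le_bound (h2 t tr) => n.
apply: le_trans (ler_norm_sum _ _ _) _; apply: le_trans (h1 n).
apply: ler_sum => j _; rewrite normrM normrX ler_wpM2l // lerXn2r ?nnegrE ?normr_ge0 ?(ltW tr) //.
exact: le_trans (normr_ge0 t) (ltW tr).
Qed.

Lemma power_series_Xexp s r L j : 0 <= r -> 0 <= L ->
  power_series s r ((`|s| + r) ^+ j * expR (- L * s + L * r)) (fun x => x ^+ j * expR (- L * x)).
Proof.
move=> r0 L0; elim: j => [|j IH].
  rewrite expr0 mul1r; have := power_series_exp s L r0; rewrite (ger0_norm L0).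
  by apply: power_series_ext => t _; rewrite expr0 mul1r.
rewrite exprS -mulrA; apply: power_series_ext (power_series_mulX r0 IH) => t _.
by rewrite exprS mulrA.
Qed.

(** This is exp(-Lx) times exp(-ux) with its first m Taylor terms removed; it is of
    size u^m. *)
Definition exp_tail L u m s : R :=
  expR (- L * s) * (expR (- u * s) - \sum_(j < m) (- u * s) ^+ j / j`!%:R).

Lemma power_series_exp_tail s r L u m : 0 < r -> 0 <= L -> 0 <= u ->
  power_series s r (expR (- L * s + L * r) * ((`|s| + r) * u) ^+ m * expR ((`|s| + r) * u))
    (exp_tail L u m).
Proof.
move=> r0 L0 u0; set A := expR (- L * s + L * r); set g := `|s| + r.
have g0 : 0 <= g by rewrite addr_ge0 // ltW.
have A0 : 0 <= A by exact: expR_ge0.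
pose F i x : R := ((- u) ^+ (m + i) / (m + i)`!%:R) * (x ^+ (m + i) * expR (- L * x)).
pose M i : R := `|(- u) ^+ (m + i) / (m + i)`!%:R| * (g ^+ (m + i) * A).
apply: (@power_series_sum _ _ _ M _ F) => //.
- by move=> i; apply: power_seriesZ; apply: power_series_Xexp => //; exact: ltW.
- move=> n; have pos j : 0 <= (g * u) ^+ j / j`!%:R by rewrite divr_ge0 // exprn_ge0 // mulr_ge0.
  have h := sums_ge0_le pos (@sums_exp R (g * u)) n.
  apply: le_trans (ler_wpM2l (mulr_ge0 A0 (exprn_ge0 m (mulr_ge0 g0 u0))) h).
  rewrite mulr_sumr; apply: ler_sum => i _.
  rewrite /M normrM normrX normrN (ger0_norm u0) (ger0_norm (x := _^-1)) ?invr_ge0 //.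
  have -> : u ^+ (m + i) / (m + i)`!%:R * (g ^+ (m + i) * A) =
     A * (g * u) ^+ m * ((g * u) ^+ i * ((m + i)`!%:R)^-1) by rewrite !exprD !exprMn; ring.
  rewrite ler_wpM2l ?mulr_ge0 ?exprn_ge0 ?mulr_ge0 // ler_wpM2l ?exprn_ge0 ?mulr_ge0 //.
  by rewrite lef_pV2 ?posrE ?ltr0n ?fact_gt0 // ler_nat; apply: leq_fact; exact: leq_addl.
- move=> t ht; set x := s + t.
  have := sumsZ (k := expR (- L * x)) (sums_tail (n := m) (@sums_exp R (- u * x))).
  by congr sums; apply/funext => i; rewrite /F exprMn; ring.
Qed.

Lemma exp_tail3 L u s :
  exp_tail L u 3 s = expR (- L * s) * (expR (- u * s) - (1 - u * s + (u * s) ^+ 2 / 2)).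
Proof.
rewrite /exp_tail !big_ord_recr big_ord0 /= !factS fact0; congr (_ * (_ - _)).
by rewrite expr0 expr1 !muln1 divr1; field.
Qed.

Lemma exp_tail2 L u s : exp_tail L u 2 s = expR (- L * s) * (expR (- u * s) - (1 - u * s)).
Proof.
rewrite /exp_tail !big_ord_recr big_ord0 /= !factS fact0; congr (_ * (_ - _)).
by rewrite expr0 expr1 !muln1 divr1; field.
Qed.

Lemma fact_geq_exp2 i : (2 * 2 ^ i <= (3 + i)`!)%N.
Proof. by elim: i => // i IH; rewrite addnS factS expnS; nia. Qed.

Lemma expR_order3 w : 0 <= w <= 1 -> 0 <= expR w - (1 + w + w ^+ 2 / 2) <= w ^+ 3.
Proof.
move=> /andP[w0 w1].
have e3 : \sum_(j < 3) w ^+ j / j`!%:R = 1 + w + w ^+ 2 / 2.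
  by rewrite !big_ord_recr big_ord0 /= !factS fact0 expr0 expr1 !muln1 divr1; field.
have pos j : 0 <= w ^+ j / j`!%:R by rewrite divr_ge0 // exprn_ge0.
apply/andP; split; first by rewrite subr_ge0 -e3; exact: sums_ge0_le pos (@sums_exp R w) 3.
apply: le_trans (ler_norm _) _; rewrite -e3.
apply: sums_le_bound (sums_tail (n := 3) (@sums_exp R w)) => n.
rewrite ger0_norm; last by apply: sumr_ge0 => j _.
apply: (@le_trans _ _ (\sum_(j < n) w ^+ 3 / 2 * (2^-1) ^+ j)).
  apply: ler_sum => j _; rewrite exprD -[leLHS]mulrA -[leRHS]mulrA ler_wpM2l ?exprn_ge0 //.
  rewrite -[leRHS]mul1r; apply: ler_pM; rewrite ?exprn_ge0 ?invr_ge0 ?exprn_ile1 //.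
  rewrite exprVn -invfM lef_pV2 ?posrE ?ltr0n ?fact_gt0 ?mulr_gt0 ?exprn_gt0 //.
  by rewrite -natrX -natrM ler_nat fact_geq_exp2.
rewrite -mulr_sumr; have := @geometric_half_le R 2^-1 n; rewrite lexx invr_ge0 ler0n => /(_ isT) hg.
have : 0 <= w ^+ 3 by rewrite exprn_ge0.
move: (w ^+ 3) (\sum_(j < n) _) hg => a b; nra.
Qed.

(** With w = ln (1 + z) the bounds on exp give z = w + w^2/2 up to w^3, and
    substituting once more replaces w^2 by z^2. *)
Lemma ln1D_order2 z : 0 <= z <= 1 ->
  [/\ 0 <= ln (1 + z), ln (1 + z) <= z, `|ln (1 + z) - z| <= 2 * z ^+ 2 &
   `|ln (1 + z) - (z - z ^+ 2 / 2)| <= 2 * z ^+ 3].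
Proof.
move=> /andP[z0 z1]; set w := ln (1 + z).
have w0 : 0 <= w by apply: ln_ge0; rewrite lerDl.
have wz : w <= z by apply: le_ln1Dx; lra.
have ew : expR w = 1 + z by rewrite /w lnK // posrE; lra.
have := @expR_order3 w; rewrite w0 (le_trans wz z1) => /(_ isT) /andP[]; rewrite ew => h1 h2.
have w3 : w ^+ 3 <= z ^+ 3 by rewrite lerXn2r ?nnegrE.
have w2 : w ^+ 2 <= z ^+ 2 by rewrite lerXn2r ?nnegrE.
have zw2 : z ^+ 3 <= z ^+ 2 by rewrite exprS ler_piMl ?exprn_ge0.
have h3 : z - w <= 3 / 2 * z ^+ 2 by lra.
have h4 : z ^+ 2 - w ^+ 2 <= 3 * z ^+ 3.
  have -> : z ^+ 2 - w ^+ 2 = (z - w) * (z + w) by ring.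
  have : (z - w) * (z + w) <= (3 / 2 * z ^+ 2) * (z + z) by apply: ler_pM => //; lra.
  have -> : 3 / 2 * z ^+ 2 * (z + z) = 3 * z ^+ 3 by field.
  by [].
have z30 : 0 <= z ^+ 3 by rewrite exprn_ge0.
have z20 : 0 <= z ^+ 2 by rewrite exprn_ge0.
by split=> //; rewrite ler_norml; apply/andP; split; lra.
Qed.

(** [slope_coef] and [curv_coef] are the coefficients of s and s^2 left in the
    bracket of [remainder] once exponentials are expanded to second order; that they
    are O(z^3) is the Euler-MacLaurin cancellation. *)
Definition slope_coef y z : R :=
  - ln (1 + y * z) + y * ln (1 + z) - (y ^+ 2 - y) / 2 * (z ^+ 2 / (1 + z)).
Definition curv_coef y z : R :=
  ln (1 + y * z) ^+ 2 / 2 - y * ln (1 + z) ^+ 2 / 2 - (y ^+ 2 - y) / 2 * (z * ln (1 + z) / (1 + z)).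

Lemma coef_bounds y z : 0 <= y <= 1 -> 0 < z <= 1 ->
  `|slope_coef y z| <= 10 * z ^+ 3 /\ `|curv_coef y z| <= 10 * z ^+ 3.
Proof.
move=> /andP[y0 y1] /andP[z0 z1].
have yz0 : 0 <= y * z by rewrite mulr_ge0 // ltW.
have yz : y * z <= z by rewrite ler_piMl // ltW.
have [|w0 wz w1 w2] := @ln1D_order2 z; first by rewrite (ltW z0).
have [|u0 uz u1 u2] := @ln1D_order2 (y * z); first by rewrite yz0 (le_trans yz).
rewrite /slope_coef /curv_coef; set u := ln (1 + y * z) in u0 uz u1 u2 *.
set w := ln (1 + z) in w0 wz w1 w2 *.
have z30 : 0 <= z ^+ 3 by rewrite exprn_ge0 // ltW.
have yz3 : (y * z) ^+ 3 <= z ^+ 3 by rewrite lerXn2r ?nnegrE // ltW.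
have yz2 : (y * z) ^+ 2 <= z ^+ 2 by rewrite lerXn2r ?nnegrE // ltW.
have z1' : 0 < 1 + z by lra.
have y2 : -1 / 2 <= (y ^+ 2 - y) / 2 <= 0.
  apply/andP; split; nra.
pose p := (y ^+ 2 - y) / 2.
have pn : `|p| <= 1 by rewrite ler_norml /p; case/andP: y2 => *; lra.
have iz : 0 < (1 + z)^-1 <= 1 by rewrite invr_gt0 z1' invf_le1 //; lra.
have izz : 1 - (1 + z)^-1 = z * (1 + z)^-1 by field; rewrite gt_eqF.
set iv := (1 + z)^-1 in iz izz *; case/andP: iz => iv0 iv1.
have zz : `|z ^+ 2 * iv - z ^+ 2| <= z ^+ 3.
  have -> : z ^+ 2 * iv - z ^+ 2 = - (z ^+ 2 * (1 - iv)) by ring.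
  rewrite izz normrN ger0_norm ?mulr_ge0 ?exprn_ge0 ?(ltW z0) ?(ltW iv0) //.
  have -> : z ^+ 2 * (z * iv) = z ^+ 3 * iv by ring.
  by rewrite ler_piMr.
split.
  have -> : - u + y * w - (y ^+ 2 - y) / 2 * (z ^+ 2 * iv) =
    - (u - (y * z - (y * z) ^+ 2 / 2)) + y * (w - (z - z ^+ 2 / 2)) - p * (z ^+ 2 * iv - z ^+ 2).
    by rewrite /p; field.
  apply: le_trans (ler_normB _ _) _; rewrite normrM.
  have h1 : `|p| * `|z ^+ 2 * iv - z ^+ 2| <= 1 * z ^+ 3 by apply: ler_pM.
  have h2 := ler_normD (- (u - (y * z - (y * z) ^+ 2 / 2))) (y * (w - (z - z ^+ 2 / 2))).
  have h3 : `|y * (w - (z - z ^+ 2 / 2))| <= 1 * (2 * z ^+ 3).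
    by rewrite normrM; apply: ler_pM => //; rewrite ger0_norm.
  rewrite normrN in h2; lra.
have hw2 : `|w ^+ 2 - z ^+ 2| <= 4 * z ^+ 3.
  have -> : w ^+ 2 - z ^+ 2 = (w - z) * (w + z) by ring.
  rewrite normrM (ger0_norm (x := w + z)); last by lra.
  have -> : 4 * z ^+ 3 = (2 * z ^+ 2) * (z + z) by ring.
  by apply: ler_pM => //; lra.
have hu2 : `|u ^+ 2 - (y * z) ^+ 2| <= 4 * z ^+ 3.
  have -> : u ^+ 2 - (y * z) ^+ 2 = (u - y * z) * (u + y * z) by ring.
  rewrite normrM (ger0_norm (x := u + y * z)); last by lra.
  have -> : 4 * z ^+ 3 = (2 * z ^+ 2) * (z + z) by ring.
  apply: ler_pM => //; lra.
have hzw : `|z * w * iv - z ^+ 2| <= 3 * z ^+ 3.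
  have -> : z * w * iv - z ^+ 2 = z * (w - z) * iv + (z ^+ 2 * iv - z ^+ 2) by ring.
  apply: le_trans (ler_normD _ _) _; rewrite !normrM (ger0_norm (ltW z0)) (ger0_norm (ltW iv0)).
  have : z * `|w - z| * iv <= (z * (2 * z ^+ 2)) * 1.
    apply: ler_pM; rewrite ?mulr_ge0 ?(ltW z0) ?(ltW iv0) // ?ler_pM2l //.
  have -> : z * (2 * z ^+ 2) * 1 = 2 * z ^+ 3 by ring.
  lra.
have -> : u ^+ 2 / 2 - y * w ^+ 2 / 2 - (y ^+ 2 - y) / 2 * (z * w * iv) =
   (u ^+ 2 - (y * z) ^+ 2) / 2 - y * ((w ^+ 2 - z ^+ 2) / 2) - p * (z * w * iv - z ^+ 2).
  by rewrite /p; field.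
apply: le_trans (ler_normB _ _) _; rewrite [`|p * _|]normrM.
have h1 : `|p| * `|z * w * iv - z ^+ 2| <= 1 * (3 * z ^+ 3) by apply: ler_pM.
have h2 := ler_normB ((u ^+ 2 - (y * z) ^+ 2) / 2) (y * ((w ^+ 2 - z ^+ 2) / 2)).
have h3 : `|y * ((w ^+ 2 - z ^+ 2) / 2)| <= 1 * (2 * z ^+ 3).
  rewrite normrM; apply: ler_pM => //; first by rewrite ger0_norm.
  rewrite normrM (ger0_norm (x := 2^-1)) //; lra.
have h4 : `|(u ^+ 2 - (y * z) ^+ 2) / 2| <= 2 * z ^+ 3.
  rewrite normrM (ger0_norm (x := 2^-1)) //; lra.
lra.
Qed.

(** With exp(L) = x, z = f/x and y = a/f this is (x+a)^-s minus the expansion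
    x^-s + y ((x+f)^-s - x^-s) + (s/2) (a^2/f - a) (x^(-s-1) - (x+f)^(-s-1)),
    the terms of Euler-MacLaurin arranged so that they telescope in x. *)
Definition remainder L y z s : R :=
  expR (- L * s) * (expR (- ln (1 + y * z) * s) - 1 - y * (expR (- ln (1 + z) * s) - 1)
   - s * ((y ^+ 2 - y) / 2) * z * (1 - expR (- ln (1 + z) * s) / (1 + z))).

Definition remainder_bound g : R := 3 * g ^+ 3 * expR g + 10 * g + 10 * g ^+ 2.

(** Expand the exponentials in ln (1+yz) and ln (1+z): the tails of order 3 are
    O(z^3), the tail of order 2 comes with a factor z, and what remains is linear in
    [slope_coef] and [curv_coef]. *)
Lemma power_series_remainder s r L y z : 0 < r -> 0 <= L -> 0 <= y <= 1 -> 0 < z <= 1 ->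
  power_series s r (expR (- L * s + L * r) * (remainder_bound (`|s| + r) * z ^+ 3))
    (remainder L y z).
Proof.
move=> r0 L0 hy hz; have [ha hb] := coef_bounds hy hz.
have [y0 y1] := andP hy; have [z0 z1] := andP hz.
have yz0 : 0 <= y * z by rewrite mulr_ge0 // ltW.
have yz : y * z <= z by rewrite ler_piMl // ltW.
have [|w0 wz _ _] := @ln1D_order2 z; first by rewrite (ltW z0).
have [|u0 uz _ _] := @ln1D_order2 (y * z); first by rewrite yz0 (le_trans yz).
set A := expR _; set g := `|s| + r.
have g0 : 0 <= g by rewrite addr_ge0 // ltW.
have A0 : 0 <= A by exact: expR_ge0.
have r0' := ltW r0.
have z1' : 0 < 1 + z by lra.
set c := (y ^+ 2 - y) / 2 * (z / (1 + z)).
have hc : `|c| <= z.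
  rewrite /c normrM -[leRHS]mul1r; apply: ler_pM => //.
    rewrite ler_norml; apply/andP; split; nra.
  by rewrite ger0_norm ?divr_ge0 ?(ltW z0) ?(ltW z1') // ler_pdivrMr //; nra.
have P1 := power_series_exp_tail s 3 r0 L0 u0.
have P2 := power_seriesZ (- y) (power_series_exp_tail s 3 r0 L0 w0).
have P3 := power_seriesZ c (power_series_mulX r0' (power_series_exp_tail s 2 r0 L0 w0)).
have P4 := power_seriesZ (slope_coef y z) (power_series_Xexp s 1 r0' L0).
have P5 := power_seriesZ (curv_coef y z) (power_series_Xexp s 2 r0' L0).
have P12 := power_seriesD r0' P1 P2.
have := power_seriesD r0' (power_seriesD r0' (power_seriesD r0' P12 P3) P4) P5.
rewrite -/A -/g => P.
apply: power_series_le (power_series_ext _ P); last first.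
  move=> t _; move: (s + t) => x; rewrite exp_tail3 exp_tail3 exp_tail2 /remainder.
  rewrite /slope_coef /curv_coef /c expr1.
  move: (expR (- L * x)) (expR (- ln (1 + z) * x)) (expR (- ln (1 + y * z) * x)) => a b d.
  by field; rewrite gt_eqF.
have zn : forall j, 0 <= z ^+ j by move=> j; rewrite exprn_ge0 // ltW.
have eb v : v <= z -> expR (g * v) <= expR g.
  by move=> vz; rewrite ler_expR ler_piMr // (le_trans vz).
have pb v j : 0 <= v -> v <= z -> (g * v) ^+ j <= g ^+ j * z ^+ j.
  by move=> v0 vz; rewrite -exprMn lerXn2r ?nnegrE ?mulr_ge0 ?(ltW z0) // ler_wpM2l.
have T v j : 0 <= v -> v <= z -> A * (g * v) ^+ j * expR (g * v) <= A * (g ^+ j * z ^+ j) * expR g.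
  move=> v0 vz; apply: ler_pM; rewrite ?expR_ge0 ?mulr_ge0 ?exprn_ge0 ?mulr_ge0 ?eb //.
  by rewrite ler_wpM2l // pb.
have uz' : ln (1 + y * z) <= z by apply: le_trans uz yz.
have T1 := T _ 3 u0 uz'.
have T2 : `|- y| * (A * (g * ln (1 + z)) ^+ 3 * expR (g * ln (1 + z))) <=
    1 * (A * (g ^+ 3 * z ^+ 3) * expR g).
  apply: ler_pM (T _ 3 w0 wz) => //; last by rewrite normrN ger0_norm.
  by rewrite ?expR_ge0 ?mulr_ge0 ?exprn_ge0 ?mulr_ge0 ?expR_ge0.
have T3 : `|c| * (g * (A * (g * ln (1 + z)) ^+ 2 * expR (g * ln (1 + z)))) <=
    z * (g * (A * (g ^+ 2 * z ^+ 2) * expR g)).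
  apply: ler_pM => //.
    by rewrite ?expR_ge0 ?mulr_ge0 ?exprn_ge0 ?mulr_ge0 ?expR_ge0.
  by rewrite ler_wpM2l // T.
have T4 : `|slope_coef y z| * (g ^+ 1 * A) <= 10 * z ^+ 3 * (g ^+ 1 * A).
  by rewrite ler_wpM2r // mulr_ge0 ?exprn_ge0.
have T5 : `|curv_coef y z| * (g ^+ 2 * A) <= 10 * z ^+ 3 * (g ^+ 2 * A).
  by rewrite ler_wpM2r // mulr_ge0 ?exprn_ge0.
apply: le_trans (lerD (lerD (lerD (lerD T1 T2) T3) T4) T5) _.
by rewrite /remainder_bound le_eqVlt; apply/orP; left; apply/eqP; ring.
Qed.

End Remainder.

Section Continuation.
Local Open Scope classical_set_scope.
Local Open Scope ring_scope.
Variable R : realType.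
Implicit Types (s t : R).

Definition npow (m : nat) (s : R) : R := expR (- ln m%:R * s).

Lemma ln_nat_ge0 (m : nat) : (0 < m)%N -> 0 <= ln m%:R :> R.
Proof. by move=> m0; apply: ln_ge0; rewrite ler1n. Qed.

Lemma npowD1 m s : (0 < m)%N -> npow m (s + 1) = npow m s / m%:R.
Proof. by move=> m0; rewrite /npow mulrDr expRD mulr1 expRN lnK // posrE ltr0n. Qed.

Lemma npowN1 m : (0 < m)%N -> npow m (- 1) = m%:R.
Proof. by move=> m0; rewrite /npow mulrNN mulr1 lnK // posrE ltr0n. Qed.

(** The square root of k + 1, written with exp and ln like the powers it is compared
    with. *)
Definition half_pow (k : nat) : R := expR (ln k.+1%:R / 2).

Lemma half_pow_sqr k : half_pow k ^+ 2 = k.+1%:R.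
Proof.
by rewrite /half_pow expr2 -expRD -splitr lnK // posrE ltr0n.
Qed.

Lemma half_pow_gt0 k : 0 < half_pow k. Proof. exact: expR_gt0. Qed.

Lemma half_pow_ge1 k : 1 <= half_pow k.
Proof.
apply: le_trans (expR_ge1Dx _); rewrite lerDl divr_ge0 //; exact: ln_nat_ge0.
Qed.

(** With p^2 = k + 1 and q^2 = k + 2 one has 1/p - 1/q = 1/(p q (p + q)), which is
    comparable to p^-3; this makes the sum of k^(-3/2) converge. *)
Lemma half_pow_telescope k : (half_pow k ^+ 3)^-1 <= 4 * ((half_pow k)^-1 - (half_pow k.+1)^-1).
Proof.
have p1 := half_pow_ge1 k; have q0 := half_pow_gt0 k.+1; have p0 := half_pow_gt0 k.
have e : half_pow k.+1 ^+ 2 = half_pow k ^+ 2 + 1 by rewrite !half_pow_sqr -[in LHS]addn1 natrD.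
move: (half_pow k) (half_pow k.+1) p1 q0 p0 e => p q p1 q0 p0 e.
have qp : 0 < q + p by rewrite addr_gt0.
have -> : p^-1 - q^-1 = (p * q * (q + p))^-1.
  have h : (q - p) * (q + p) = 1.
    have -> : (q - p) * (q + p) = q ^+ 2 - p ^+ 2 by ring.
    by rewrite e addrC addKr.
  have -> : p^-1 - q^-1 = (q - p) / (p * q) by field; rewrite !gt_eqF.
  rewrite [RHS]invfM -[(q + p)^-1]mul1r -h.
  by field; rewrite !gt_eqF.
have : p * q * (q + p) <= 4 * p ^+ 3.
  have -> : p * q * (q + p) = p * (q ^+ 2 + p * q) by ring.
  have -> : 4 * p ^+ 3 = p * (4 * p ^+ 2) by ring.
  rewrite ler_pM2l // e; have : p ^+ 2 >= 1 by rewrite expr_ge1 // ltW.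
  have : 0 <= (q - p) ^+ 2 by rewrite sqr_ge0.
  have -> : (q - p) ^+ 2 = q ^+ 2 + p ^+ 2 - 2 * (p * q) by ring.
  rewrite e; lra.
by move=> h; rewrite ler_pdivlMr ?mulr_gt0 // mulrC ler_pdivrMr ?exprn_gt0.
Qed.

Lemma sum_half_pow n : \sum_(k < n) (half_pow k ^+ 3)^-1 <= 4.
Proof.
have : \sum_(k < n) (half_pow k ^+ 3)^-1 <= 4 * (1 - (half_pow n)^-1).
  elim: n => [|n IH]; first by rewrite big_ord0 /half_pow ln1 mul0r expR0 invr1 subrr mulr0.
  rewrite big_ord_recr /=; have := half_pow_telescope n; lra.
have p0 : 0 < (half_pow n)^-1 by rewrite invr_gt0 half_pow_gt0.
lra.
Qed.

Section Block.
Variables (f a : nat).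
Hypotheses (f0 : (0 < f)%N) (af : (a <= f)%N).

Let y : R := a%:R / f%:R.
Let hy : 0 <= y <= 1.
Proof.
by rewrite /y divr_ge0 //= ler_pdivrMr ?ltr0n // mul1r ler_nat.
Qed.

Let z (k : nat) : R := k.+1%:R^-1.
Let hz k : 0 < z k <= 1.
Proof. by rewrite /z invr_gt0 ltr0n invf_le1 ?ltr0n // ler1n. Qed.

Definition block_remainder (k : nat) s : R := remainder (ln (k.+1 * f)%:R) y (z k) s.

Lemma block_remainderE k s : block_remainder k s =
  npow (k.+1 * f + a) s - npow (k.+1 * f) s - y * (npow (k.+2 * f) s - npow (k.+1 * f) s)
  - s / 2 * (a%:R * y - a%:R) * (npow (k.+1 * f) (s + 1) - npow (k.+2 * f) (s + 1)).
Proof.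
have kf0 : (0 < k.+1 * f)%N by rewrite muln_gt0.
have kf0' : (0 < k.+2 * f)%N by rewrite muln_gt0.
have fR : f%:R != 0 :> R by rewrite pnatr_eq0 -lt0n.
have kR : k.+1%:R != 0 :> R by rewrite pnatr_eq0.
have kR2 : k.+2%:R != 0 :> R by rewrite pnatr_eq0.
rewrite !npowD1 //.
have zk : 1 + z k = k.+2%:R / k.+1%:R by rewrite /z -[k.+2%:R]natr1 mulrDl divff // mul1r addrC.
have ya : a%:R = y * f%:R by rewrite /y divfK.
have e1 : (k.+1 * f + a)%:R = (k.+1 * f)%:R * (1 + y * z k) :> R.
  rewrite natrD ya natrM /z; field; rewrite addrC natr1 //.
have e2 : (k.+2 * f)%:R = (k.+1 * f)%:R * (1 + z k) :> R.
  by rewrite zk !natrM; field; rewrite addrC natr1.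
have p1 : (1 + y * z k) \is Num.pos.
  have /andP[y0 _] := hy; have /andP[z0 _] := hz k.
  by rewrite posrE; have := mulr_ge0 y0 (ltW z0); lra.
have p2 : (1 + z k) \is Num.pos by have /andP[z0 _] := hz k; rewrite posrE; lra.
have p3 : (k.+1 * f)%:R \is @Num.pos R by rewrite posrE ltr0n.
rewrite /block_remainder /remainder /npow e1 e2 !lnM // !opprD !mulrDl !expRD.
rewrite zk ya natrM /z.
move: (expR _) (expR _) (expR _) => A B C.
have -> : k.+2%:R = k.+1%:R + 1 :> R by rewrite natr1.
move: kR kR2; have -> : k.+2%:R = k.+1%:R + 1 :> R by rewrite natr1.
move: (k.+1%:R : R) (f%:R : R) fR => K F0 F0n K0 K10; by field; rewrite F0n K0 K10.
Qed.

(** At s = -1 the power is the identity function, which the expansion reproduces, and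
    the last difference is 1 - 1. *)
Lemma block_remainderN1 k : block_remainder k (- 1) = 0.
Proof.
have fR : f%:R != 0 :> R by rewrite pnatr_eq0 -lt0n.
have kf0 : (0 < k.+1 * f)%N by rewrite muln_gt0.
have kf0' : (0 < k.+2 * f)%N by rewrite muln_gt0.
have kfa : (0 < k.+1 * f + a)%N by rewrite addn_gt0 kf0.
rewrite block_remainderE (npowN1 kf0) (npowN1 kf0') (npowN1 kfa) addNr.
rewrite /npow !mulr0 subrr mulr0 subr0.
have -> : (k.+2 * f)%N = (k.+1 * f + f)%N by rewrite mulSn addnC.
by rewrite !natrD /y; field.
Qed.

(** The radius 1/2 still leaves the exponent -s + 1/2 - 3 at most -3/2 for s >= -1. *)
Lemma block_remainder_series s : - 1 <= s -> exists M, forall n,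
    \sum_(k < n) (expR (- ln (k.+1 * f)%:R * s + ln (k.+1 * f)%:R / 2)
     * (remainder_bound (`|s| + 2^-1) * z k ^+ 3)) <= M.
Proof.
move=> s1; set Kb := remainder_bound _.
have Kb0 : 0 <= Kb.
  by rewrite /Kb /remainder_bound !addr_ge0 // !mulr_ge0 // ?exprn_ge0 ?addr_ge0 ?expR_ge0.
pose Cf : R := expR (3 / 2 * ln f%:R).
exists (Cf * Kb * 4) => n.
apply: le_trans (ler_wpM2l (mulr_ge0 (expR_ge0 _) Kb0) (sum_half_pow n)).
rewrite mulr_sumr; apply: ler_sum => k _.
have L0 : 0 <= ln (k.+1 * f)%:R :> R by rewrite ln_nat_ge0 // muln_gt0.
have hp : expR (3 / 2 * ln k.+1%:R) = half_pow k ^+ 3.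
  rewrite /half_pow -expRM_natl; congr expR; by field.
have z3 : z k ^+ 3 = (half_pow k ^+ 3)^-1 ^+ 2.
  by rewrite /z -half_pow_sqr !exprVn -!exprM.
apply: (@le_trans _ _ (Cf * half_pow k ^+ 3 * (Kb * z k ^+ 3))).
  rewrite ler_wpM2r //; first by rewrite mulr_ge0 // exprn_ge0 //; have /andP[/ltW] := hz k.
  rewrite /Cf -hp -expRD ler_expR -mulrDr [ln f%:R + _]addrC -lnM ?posrE ?ltr0n // -natrM.
  move: (ln _) L0 => L L0; nra.
rewrite z3 le_eqVlt; apply/orP; left; apply/eqP.
have := half_pow_gt0 k; move: (half_pow k) => p p0; rewrite -/Cf; field.
by rewrite gt_eqF.
Qed.

Definition remainder_sum s : R := limn (series (fun k => block_remainder k s)).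

Lemma remainder_sum_power_series s : - 1 <= s -> exists M,
  power_series s 2^-1 M remainder_sum /\ sums (fun k => block_remainder k s) (remainder_sum s).
Proof.
move=> s1; have [M hM] := block_remainder_series s1.
have r0 : 0 < (2^-1 : R) by rewrite invr_gt0.
have kf k : (0 < k.+1 * f)%N by rewrite muln_gt0.
have ps k : power_series s 2^-1 _ (block_remainder k) :=
  power_series_remainder s r0 (ln_nat_ge0 (kf k)) hy (hz k).
exists M; have hs t : `|t| < 2^-1 ->
    sums (fun k => block_remainder k (s + t)) (remainder_sum (s + t)).
  move=> ht; have [l hl] : exists l, sums (fun k => block_remainder k (s + t)) l.
    apply: (sums_abs (M := M)) => n; apply: le_trans (hM n).
    apply: ler_sum => k _; apply: power_series_norm ht; exact: ps.
  by rewrite /remainder_sum; have := hl; rewrite -sumsE => /cvg_lim ->.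
split; last by have := hs 0; rewrite addr0 normr0 => /(_ r0).
exact: (power_series_sum r0 ps hM hs).
Qed.

End Block.
End Continuation.

(** * Second moments of periodic even functions *)

Section PeriodicSums.
Variable K : numFieldType.
Implicit Types (g : int -> K) (H : nat -> K).

Definition has_period (f : nat) g := forall a, g (a + f%:Z) = g a.

Lemma has_periodM f g : has_period f g -> forall (k : nat) a, g (a + (k * f)%N%:Z) = g a.
Proof.
move=> hg; elim=> [|k IH] a; first by rewrite mul0n addr0.
by rewrite mulSn addnC PoszD addrA hg IH.
Qed.

Lemma has_period_mod f g (b : nat) : has_period f g -> g (b %% f)%N%:Z = g b%:Z.
Proof.
by move=> hg; rewrite {2}(divn_eq b f) addnC PoszD has_periodM.
Qed.

Lemma sum_mul_mod (F c : nat) H : (0 < F)%N -> coprime c F ->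
  \sum_(a < F) H a = \sum_(b < F) H ((c * b) %% F)%N.
Proof.
move=> F0 cF; pose t (b : 'I_F) := Ordinal (ltn_pmod (c * b) F0).
rewrite (reindex_inj (h := t)) //= => a b /(congr1 val) /= /eqP e.
apply: val_inj => /=; move: e.
wlog ab : a b / (a <= b)%N.
  by move=> W; case: (leqP a b) => [|/ltnW] h /eqP e; [|symmetry]; apply: W => //; apply/eqP.
rewrite eq_sym eqn_mod_dvd ?leq_mul2l ?ab ?orbT // -mulnBr Gauss_dvdr 1?coprime_sym //.
have lt_b := ltn_ord b.
case: (posnP (b - a)%N) => [|/dvdn_leq h /h]; lia.
Qed.

(** Multiplication by c permutes the residues and multiplies the sum by k. *)
Lemma sum_twist_eq0 (F c : nat) g (k : K) : (0 < F)%N -> coprime c F ->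
  has_period F g -> (forall b : nat, g (c * b)%N%:Z = k * g b%:Z) -> k != 1 ->
  \sum_(a < F) g a%:Z = 0.
Proof.
move=> F0 cF per gM k1.
have : (1 - k) * \sum_(a < F) g a%:Z = 0.
  rewrite mulrBl mul1r {1}(sum_mul_mod (fun a => g a%:Z) F0 cF) mulr_sumr -sumrB.
  by apply: big1 => b _; rewrite has_period_mod // gM subrr.
move/eqP; rewrite mulf_eq0 subr_eq0 eq_sym (negPf k1) /= => /eqP //.
Qed.

Definition second_moment (f : nat) g := \sum_(a < f) g a%:Z * a%:R ^+ 2.

(** Equals -B_(2,g)/2, the value at -1 of the continued Dirichlet series of g, when g is
    even with period f and sum 0 over a period. *)
Definition Lval (f : nat) g := - second_moment f g / (2 * f%:R).

(** The reflection a -> f - a turns the sum into f times the sum of g minus itself. *)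
Lemma sum_mul_id_even (f : nat) g : has_period f g -> (forall a, g (- a) = g a) ->
  g 0 = 0 -> \sum_(a < f) g a%:Z = 0 -> \sum_(a < f) g a%:Z * a%:R = 0.
Proof.
case: f => [|f] per ev g0; first by rewrite !big_ord0.
rewrite !big_ord_recl /= g0 add0r mulr0 add0r => sg.
have e : \sum_(i < f) g (bump 0 i)%:Z * (bump 0 i)%:R =
   \sum_(i < f) g (bump 0 i)%:Z * (f.+1%:R - (bump 0 i)%:R).
  rewrite (reindex_inj rev_ord_inj) /=; apply: eq_bigr => i _.
  have lti := ltn_ord i.
  rewrite /bump !add1n -natrB; last by lia.
  congr (_ * _%:R); last by lia.
  rewrite -(ev i.+1%:Z) -(per (- i.+1%:Z)); congr g; lia.
move: e; under [in RHS]eq_bigr do rewrite mulrBr.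
rewrite sumrB -mulr_suml sg mul0r sub0r => /eqP.
by rewrite -addr_eq0 -mulr2n mulrn_eq0 /= => /eqP.
Qed.

Section Distribution.
Variables (f : nat) (g : int -> K).
Hypotheses (per : has_period f g) (ev : forall a, g (- a) = g a) (g0 : g 0 = 0).
Hypothesis sg : \sum_(a < f) g a%:Z = 0.

(** In the j-th period (a + j f)^2 differs from a^2 by terms whose sums against g are
    moments of order 0 and 1. *)
Lemma second_moment_mul k : second_moment (k * f) g = k%:R * second_moment f g.
Proof.
elim: k => [|k IH]; first by rewrite mul0n /second_moment big_ord0 mul0r.
rewrite mulSn addnC /second_moment big_split_ord /= -/(second_moment (k * f) g) IH.
rewrite -natr1 mulrDl mul1r.
congr (_ + _).
transitivity (\sum_(a < f) (g a%:Z * a%:R ^+ 2 + 2%:R * (k * f)%:R * (g a%:Z * a%:R)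
   + (k * f)%:R ^+ 2 * g a%:Z)).
  by apply: eq_bigr => a _; rewrite addnC PoszD has_periodM // natrD; ring.
by rewrite !big_split /= -!mulr_sumr sum_mul_id_even // sg !mulr0 !addr0.
Qed.

Lemma Lval_mul k : (0 < k)%N -> (0 < f)%N -> Lval (k * f) g = Lval f g.
Proof.
move=> k0 f0; rewrite /Lval second_moment_mul natrM.
have : k%:R != 0 :> K by rewrite pnatr_eq0 -lt0n.
have : f%:R != 0 :> K by rewrite pnatr_eq0 -lt0n.
by move=> h1 h2; field; rewrite h1 h2.
Qed.
End Distribution.

Lemma sum_multiples (p f : nat) H : (0 < p)%N ->
  \sum_(a < f * p) (if (p %| a)%N then H a else 0) = \sum_(b < f) H (b * p)%N.
Proof.
move=> p0; elim: f => [|f IH]; first by rewrite mul0n !big_ord0.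
rewrite big_ord_recr /= -IH mulSn addnC big_split_ord /=; congr (_ + _).
case: p p0 {IH} => // p _; rewrite big_ord_recl /= addn0 dvdn_mull // big1 ?addr0 // => i _.
rewrite /bump add1n dvdn_addr ?dvdn_mull // gtnNdvd // ltnS; exact: ltn_ord.
Qed.

(** The multiples of p contribute p^2 g(p) times the second moment over f, and both
    moments have the same normalised value by [Lval_mul]. *)
Lemma Lval_euler (p f : nat) g : (0 < p)%N -> (0 < f)%N ->
  has_period f g -> (forall a, g (- a) = g a) -> g 0 = 0 ->
  \sum_(a < f) g a%:Z = 0 ->
  (forall b : nat, g (b * p)%N%:Z = g b%:Z * g p%:Z) ->
  Lval (f * p) (fun a => if (p%:Z %| a)%Z then 0 else g a)
   = (1 - g p%:Z * p%:R) * Lval (f * p) g.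
Proof.
move=> p0 f0 per ev g0 sg mg.
have e : second_moment (f * p) (fun a => if (p%:Z %| a)%Z then 0 else g a) =
  second_moment (f * p) g - p%:R ^+ 2 * g p%:Z * second_moment f g.
  rewrite {2}/second_moment mulr_sumr.
  have <- : \sum_(i < f * p) (if (p %| i)%N then g i%:Z * i%:R ^+ 2 else 0) =
    \sum_(b < f) p%:R ^+ 2 * g p%:Z * (g b%:Z * b%:R ^+ 2).
    rewrite (sum_multiples _ (fun i => g i%:Z * i%:R ^+ 2)) //.
    by apply: eq_bigr => b _; rewrite mg natrM; ring.
  rewrite -sumrB; apply: eq_bigr => a _; rewrite -[(p%:Z %| a%:Z)%Z]/(p %| a)%N.
  by case: (p %| a)%N; rewrite ?subr0 // mul0r subrr.
have -> : Lval (f * p) g = Lval f g by rewrite mulnC Lval_mul.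
rewrite /Lval e (mulnC f) second_moment_mul // natrM.
have : p%:R != 0 :> K by rewrite pnatr_eq0 -lt0n.
have : f%:R != 0 :> K by rewrite pnatr_eq0 -lt0n.
by move=> h1 h2; field; rewrite h1 h2.
Qed.

Section MultiplierTrick.
Variables (F c : nat) (g : int -> K) (k : K).
Hypotheses (F0 : (0 < F)%N) (cF : coprime c F) (per : has_period F g).
Hypothesis gM : forall b : nat, g (c * b)%N%:Z = k * g b%:Z.

Let q (b : nat) : nat := (c * b %/ F)%N.

(** Replace the summation variable by the residue of c b, which is c b - F q(b), and
    expand the square. *)
Lemma multiplier_identity : (1 - k * c%:R ^+ 2) * second_moment F g =
  k * (F%:R ^+ 2 * \sum_(b < F) g b%:Z * (q b)%:R ^+ 2
       - 2%:R * F%:R * c%:R * \sum_(b < F) g b%:Z * (b%:R * (q b)%:R)).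
Proof.
rewrite mulrBl mul1r {1}/second_moment (sum_mul_mod (fun a => g a%:Z * a%:R ^+ 2) F0 cF).
have e (b : nat) : ((c * b) %% F)%:R = c%:R * b%:R - F%:R * (q b)%:R :> K.
  by rewrite -!natrM {2}(divn_eq (c * b) F) natrD -/(q b) (mulnC (q b)) addrC addKr.
transitivity (\sum_(b < F) (k * c%:R ^+ 2 * (g b%:Z * b%:R ^+ 2) +
  k * (F%:R ^+ 2 * (g b%:Z * (q b)%:R ^+ 2)) -
  k * (2%:R * F%:R * c%:R * (g b%:Z * (b%:R * (q b)%:R)))) - k * c%:R ^+ 2 * second_moment F g).
  by congr (_ - _); apply: eq_bigr => b _; rewrite has_period_mod // gM e; ring.
rewrite sumrB big_split /= -!mulr_sumr -/(second_moment F g); ring.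
Qed.
End MultiplierTrick.

Lemma sum_odd (m : nat) H : (forall b, ~~ odd b -> H b = 0) ->
  \sum_(b < m.*2) H b = \sum_(i < m) H i.*2.+1.
Proof.
move=> hH; elim: m => [|m IH]; first by rewrite !big_ord0.
by rewrite doubleS !big_ord_recr /= IH (hH m.*2) ?odd_double // addr0.
Qed.

Lemma sum_fold (F : nat) H : (forall b, ~~ odd b -> H b = 0) ->
  \sum_(b < F.*2.*2) H b = \sum_(i < F) (H i.*2.+1 + H (F.*2.*2 - i.*2.+1)%N).
Proof.
move=> hH; rewrite sum_odd // -addnn big_split_ord /= big_split /=; congr (_ + _).
rewrite (reindex_inj rev_ord_inj) /=; apply: eq_bigr => i _; congr H.
have := ltn_ord i; lia.
Qed.

Section MultiplierFold.
Variables (F c e : nat) (g : int -> K) (k : K).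
Let N := F.*2.*2.
Hypotheses (F0 : (0 < F)%N) (cN : coprime c N) (per : has_period N g) (ce : c = e.*2.+1).
Hypothesis gM : forall b : nat, g (c * b)%N%:Z = k * g b%:Z.
Hypotheses (ev : forall a, g (- a) = g a).
Hypothesis (geven : forall b : nat, ~~ odd b -> g b%:Z = 0).
Let q (b : nat) : nat := (c * b %/ N)%N.

(** Half of b q(b) + (N - b) q(N - b) for odd b, where q(b) is the quotient of c b by N:
    the joint contribution of b and of its reflection. *)
Definition fold_weight (b : nat) : int :=
  b%:Z * (q b)%:Z + (N%:Z - b%:Z) * e%:Z - (F.*2)%:Z * (q b)%:Z.

Lemma quotient_reflect (b : nat) : odd b -> (b < N)%N -> q (N - b) = (c.-1 - q b)%N.
Proof.
move=> hb bN; have N0 : (0 < N)%N by rewrite /N; lia.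
have r0 : (c * b %% N != 0)%N.
  apply/negP => h; have : (N %| b)%N by rewrite -(Gauss_dvdr (n := c)) 1?coprime_sym.
  by move/dvdn_leq; lia.
have := divn_eq (c * b) N; have := ltn_pmod (c * b) N0; rewrite -/(q b) /q.
set r := (c * b %% N)%N in r0 *; set Q := q b => rN e1.
have qc : (Q < c)%N.
  rewrite -(ltn_pmul2r N0); apply: (@leq_ltn_trans (c * b)); first by rewrite e1 leq_addr.
  by rewrite ltn_pmul2l // ce.
have -> : (c * (N - b) = (c.-1 - Q) * N + (N - r))%N.
  rewrite mulnBr e1 mulnBl.
  have : (Q * N <= c.-1 * N)%N by rewrite leq_mul2r; lia.
  have : (c * N = c.-1 * N + N)%N by rewrite ce /= mulSn addnC.
  move: rN; move: (c * N)%N (c.-1 * N)%N (Q * N)%N => x y z; lia.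
by rewrite divnMDl // divn_small ?addn0 //; lia.
Qed.

(** [multiplier_identity] with b and N - b grouped together.  The grouping is what
    produces the factor 2, hence the term 1 in the final valuation. *)
Lemma fold_identity : (1 - k * c%:R ^+ 2) * Lval N g =
  2%:R * k * (c%:R * (\sum_(i < F) g i.*2.+1%:Z * (fold_weight i.*2.+1)%:~R)
      - F%:R * (\sum_(b < N) g b%:Z * ((q b)%:R ^+ 2))).
Proof.
have N0 : (0 < N)%N by rewrite /N; lia.
rewrite /Lval mulNr mulrN mulrA (multiplier_identity N0 cN per gM).
have -> : \sum_(b < N) g b%:Z * (b%:R * (q b)%:R) =
  2%:R * \sum_(i < F) g i.*2.+1%:Z * (fold_weight i.*2.+1)%:~R.
  rewrite (sum_fold F (H := fun b => g b%:Z * (b%:R * (q b)%:R))); last first.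
    by move=> b hb; rewrite geven // mul0r.
  rewrite mulr_sumr; apply: eq_bigr => i _; set b := i.*2.+1.
  have bN : (b < N)%N by rewrite /b /N; have := ltn_ord i; lia.
  have -> : g (N - b)%N%:Z = g b%:Z.
    rewrite -(ev b%:Z) -(per (- b%:Z)); congr g; lia.
  rewrite quotient_reflect ?/b //=; last by rewrite odd_double.
  rewrite -/b -mulrDr mulrCA; congr (_ * _).
  have qe : (q b <= c.-1)%N.
    by rewrite -ltnS prednK ?ce // -ce /q ltn_divLR // ltn_pmul2l // ce.
  rewrite -!natrM -natrD -[LHS]/(Posz _)%:~R -[2%:R]/((2 : int)%:~R) -intrM.
  congr (_%:~R).
  rewrite /fold_weight; move: qe; rewrite ce /=; move: (q b) => Q qe.
  rewrite PoszD !PoszM -!subzn; [|lia|lia].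
  have NE : F.*2.*2%:Z = F.*2%:Z * 2 by lia.
  have -> : e.*2%:Z = e%:Z * 2 by lia.
  rewrite /N NE; ring.
have NF : N%:R = 4%:R * F%:R :> K by rewrite -natrM /N; congr (_%:R); lia.
have F0' : F%:R != 0 :> K by rewrite pnatr_eq0 -lt0n.
by rewrite NF; field.
Qed.
End MultiplierFold.

End PeriodicSums.

(** * The value at -1 of the Dirichlet series of a periodic even function *)

Section RealValue.
Local Open Scope classical_set_scope.
Local Open Scope ring_scope.
Variables (R : realType) (f : nat) (alpha : nat -> R).
Hypotheses (f0 : (0 < f)%N) (per : forall m, alpha (m + f)%N = alpha m) (alpha0 : alpha 0%N = 0).
Hypotheses (s0 : \sum_(a < f) alpha a = 0) (s1 : \sum_(a < f) alpha a * a%:R = 0).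
Implicit Types s t : R.

Let c2 : R := \sum_(a < f) alpha a * a%:R ^+ 2.

(** The continuation to s >= -1 of the series of alpha: the remainders of all blocks
    k >= 1, the block k = 0, and the boundary term of the telescoping part. *)
Definition continued_sum s : R :=
  \sum_(a < f) alpha a * (npow a s + remainder_sum f a s) +
  c2 / (2 * f%:R) * (s * npow f (s + 1)).

Lemma npow_power_series m s r : (0 < m)%N -> 0 <= r ->
  power_series s r (expR (- ln m%:R * s + ln m%:R * r)) (npow m).
Proof.
move=> m0 r0; have := power_series_exp s (ln m%:R) r0.
by rewrite (ger0_norm (ln_nat_ge0 _ m0)).
Qed.

Lemma continued_sum_analytic s : - 1 <= s -> analytic_at s continued_sum.
Proof.
move=> sN1; have r0 : 0 < (2^-1 : R) by rewrite invr_gt0.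
have hterm (a : 'I_f) : exists M,
    power_series s 2^-1 M (fun x => alpha a * (npow a x + remainder_sum f a x)).
  (* the power of 0 is a junk value; alpha kills it *)
  have [a0|a0] := posnP a.
    exists 0; apply: power_series_ext (power_series0 s 2^-1) => t _.
    by rewrite a0 alpha0 mul0r.
  have [M [hM _]] := remainder_sum_power_series f0 (ltnW (ltn_ord a)) sN1.
  exists (`|alpha a| * (expR (- ln a%:R * s + ln a%:R / 2) + M)); apply: power_seriesZ.
  by apply: power_seriesD (npow_power_series s a0 (ltW r0)) hM; exact: ltW.
have [M hM] := choice hterm.
have P1 := power_series_bigsum (index_enum 'I_f) (P := xpredT) (ltW r0) (fun a _ => hM a).
have P2 := npow_power_series s f0 (ltW r0).
have P3 := power_seriesZ (c2 / (2 * f%:R) / f%:R) (power_series_mulX (ltW r0) P2).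
apply: (power_series_analytic r0).
apply: power_series_ext (power_seriesD (ltW r0) P1 P3) => t _.
rewrite /continued_sum npowD1 //; congr (_ + _); by rewrite -!mulrA; congr (_ * _); ring.
Qed.

Lemma alpha_mod k a : alpha (k * f + a) = alpha a.
Proof. by elim: k => [|k IH]; rewrite ?add0n // mulSn -addnA addnC per IH. Qed.

(** The hypotheses on the moments of order 0 and 1 cancel every subtracted term except
    the telescoping one. *)
Lemma block_sum k s : \sum_(a < f) alpha a * npow (k.+1 * f + a) s =
  \sum_(a < f) alpha a * block_remainder f a k s +
  c2 / (2 * f%:R) * (s * (npow (k.+1 * f) (s + 1) - npow (k.+2 * f) (s + 1))).
Proof.
set D := npow (k.+1 * f) (s + 1) - _.
set A := npow (k.+1 * f) s; set B := npow (k.+2 * f) s.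
have fR : f%:R != 0 :> R by rewrite pnatr_eq0 -lt0n.
have -> : \sum_(a < f) alpha a * block_remainder f a k s =
  \sum_(a < f) alpha a * npow (k.+1 * f + a) s - A * (\sum_(a < f) alpha a)
   - ((B - A) / f%:R - s / 2 * D) * (\sum_(a < f) alpha a * a%:R) - s / 2 * D / f%:R * c2.
  rewrite /c2 !mulr_sumr -!sumrB; apply: eq_bigr => a _.
  rewrite (block_remainderE f0 (ltnW (ltn_ord a))) -/A -/B -/D; field.
  by [].
by rewrite s0 s1 !mulr0 !subr0; field.
Qed.

Lemma partial_sum K s : \sum_(m < K.+1 * f) alpha m * npow m s =
  \sum_(a < f) alpha a * npow a s
  + \sum_(k < K) \sum_(a < f) alpha a * block_remainder f a k s
  + c2 / (2 * f%:R) * (s * (npow f (s + 1) - npow (K.+1 * f) (s + 1))).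
Proof.
elim: K => [|K IH].
  by rewrite big_ord0 mul1n addr0 subrr !mulr0 addr0.
have eN : (K.+2 * f)%N = (K.+1 * f + f)%N by rewrite mulSn addnC.
rewrite [in LHS]eN big_split_ord /= IH big_ord_recr /=.
under [X in _ + X = _]eq_bigr do rewrite alpha_mod.
rewrite (block_sum K s); move: (npow (K.+2 * f) (s + 1)) (npow (K.+1 * f) (s + 1)) => x y.
by move: (\sum_(k < K) _) (\sum_(a < f) _ * block_remainder _ _ _ _) => u w; ring.
Qed.

Lemma partial_sum_cvg s : 0 <= s <= 2 ->
  (fun K => \sum_(m < K.+1 * f) alpha m * npow m s) @ \oo --> continued_sum s.
Proof.
move=> /andP[s_ge0 s_le2].
under eq_fun do rewrite partial_sum.
have -> : continued_sum s =
    \sum_(a < f) alpha a * npow a s + \sum_(a < f) alpha a * remainder_sum f a s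
    + c2 / (2 * f%:R) * (s * npow f (s + 1)).
  by rewrite /continued_sum; under eq_bigr do rewrite mulrDr; rewrite big_split.
apply: cvgD; first apply: cvgD.
- exact: cvg_cst.
- have h : sums (fun k => \sum_(a < f) alpha a * block_remainder f a k s)
     (\sum_(a < f) alpha a * remainder_sum f a s).
    apply: sums_bigsum => a _; apply: sumsZ.
    have [|M [_ h]] := remainder_sum_power_series f0 (ltnW (ltn_ord a)) (s := s); last exact: h.
    lra.
  exact: h.
- apply: cvgMl_tmp; apply: cvgMl_tmp.
  rewrite -[X in _ --> X]subr0; apply: cvgB; first exact: cvg_cst.
  apply: (@squeeze_cvgr _ _ _ _ (fun=> 0) (@harmonic R)).
  + apply: nearW => K; rewrite expR_ge0 /=.
    have mf : (0 < K.+1 * f)%N by rewrite muln_gt0.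
    rewrite npowD1 // /npow.
    have h1 : expR (- ln (K.+1 * f)%:R * s) <= 1.
      by rewrite expR_le1 mulNr oppr_le0 mulr_ge0 // ln_nat_ge0.
    apply: (@le_trans _ _ (1 / (K.+1 * f)%:R)); first by rewrite ler_wpM2r ?invr_ge0.
    by rewrite mul1r lef_pV2 ?posrE ?ltr0n // ler_nat leq_pmulr.
  + exact: cvg_cst.
  + exact: cvg_harmonic.
Qed.

(** [continued_sum] agrees with L on ]1, 2], hence at -1, where all remainders vanish,
    the block k = 0 is the first moment, and only the boundary term is left. *)
Theorem periodic_series_value (L : R -> R) : (forall s, analytic_at s L) ->
  (forall s, 1 < s -> sums (fun k => alpha k.+1 * npow k.+1 s) (L s)) ->
  L (- 1) = - c2 / (2 * f%:R).
Proof.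
move=> an hL.
have N1 : continued_sum (- 1) = - c2 / (2 * f%:R).
  have tail0 (a : 'I_f) : remainder_sum f a (- 1) = 0 :> R.
    have [//|M [_ h]] := @remainder_sum_power_series R f a f0 (ltnW (ltn_ord a)) (- 1).
    apply: sums_unique h _; rewrite (_ : (fun _ => _) = fun=> 0); first exact: sums0.
    by apply/funext => k; rewrite block_remainderN1 // ltnW.
  rewrite /continued_sum addNr [npow f 0]/npow mulr0 expR0.
  have -> : \sum_(a < f) alpha a * (npow a (- 1) + remainder_sum f a (- 1)) =
      \sum_(a < f) alpha a * a%:R.
    apply: eq_bigr => a _; rewrite tail0 addr0.
    have [->|a0] := posnP a; first by rewrite alpha0 !mul0r.
    by rewrite npowN1.
  by rewrite s1 add0r mulr1 mulrN1 mulNr.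
rewrite -N1; apply/eqP; rewrite -subr_eq0; apply/eqP.
apply: (@identity_theorem R (- 1) 2 (fun s => L s - continued_sum s)).
- lra.
- by move=> s /andP[h _]; apply: analytic_atB => //; exact: continued_sum_analytic.
exists 1; first by apply/andP; split; lra.
move=> s /andP[s_gt1 s_le2]; apply/eqP; rewrite subr_eq0; apply/eqP.
have hs : 0 <= s <= 2 by apply/andP; split=> //; lra.
apply: cvg_unique _ (partial_sum_cvg hs) => //.
have hLs := hL s s_gt1; move: hLs; rewrite /sums => hLs.
apply/cvgrPdist_le => e e0.
have [N _ hN] : \forall n \near \oo, `|L s - \sum_(j < n) alpha j.+1 * npow j.+1 s| <= e.
  by move/cvgrPdist_le: hLs => /(_ e e0).
exists N => // K /= NK.
have -> : \sum_(m < K.+1 * f) alpha m * npow m s =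
    \sum_(j < (K.+1 * f).-1) alpha j.+1 * npow j.+1 s.
  have kf : (0 < K.+1 * f)%N by rewrite muln_gt0.
  by case: (K.+1 * f)%N kf => // m _; rewrite big_ord_recl alpha0 mul0r add0r.
apply: hN => /=; apply: leq_trans NK _.
by rewrite -ltnS prednK ?muln_gt0 // leq_pmulr.
Qed.

End RealValue.

Section Coordinate.
Local Open Scope classical_set_scope.
Local Open Scope ring_scope.
Variables (R : realType) (phi : R[i] -> R).
Hypotheses (phiD : forall x y, phi (x + y) = phi x + phi y).
Hypotheses (phiZ : forall x (r : R), phi (x * r%:C) = phi x * r).
Hypotheses (phi_le : forall x, `|phi x|%:C <= `|x|).

Let phi0 : phi 0 = 0.
Proof. by have := phiZ 0 0; rewrite mul0r mulr0. Qed.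

Let phiB x y : phi (x - y) = phi x - phi y.
Proof. by apply/eqP; rewrite eq_sym subr_eq -phiD subrK. Qed.

Let phi_sum (I : Type) (s : seq I) (P : pred I) (F : I -> R[i]) :
  phi (\sum_(i <- s | P i) F i) = \sum_(i <- s | P i) phi (F i).
Proof. exact: (big_morph phi phiD phi0). Qed.

(** Both the expansions of L at real points and its Dirichlet series have real variable
    parts, so a coordinate of L along the real axis falls under the real theory. *)
Lemma cvg_coordinate (u : nat -> R[i]) (l : R[i]) :
  series (u : nat -> R[i]^o) @ \oo --> (l : R[i]^o) -> sums (fun n => phi (u n)) (phi l).
Proof.
move=> /cvgrPdist_le h; apply/cvgrPdist_le => e e0.
have e0' : 0 < e%:C :> R[i] by rewrite ltcR.
have [N _ hN] := h _ e0'; exists N => // n Nn.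
have := hN n Nn; rewrite /= -phi_sum -phiB => hn.
rewrite -lecR; apply: le_trans (phi_le _) _.
by move: hn; rewrite /series /= big_mkord.
Qed.

Variables (rho : nat -> R[i]) (L : R[i] -> R[i]) (f : nat).
Hypothesis hL : is_dirichlet_L rho L.
Hypotheses (f0 : (0 < f)%N) (per : forall m, rho (m + f)%N = rho m) (rho0 : rho 0%N = 0).
Hypotheses (s0 : \sum_(a < f) rho a = 0) (s1 : \sum_(a < f) rho a * a%:R = 0).

Lemma natC (m : nat) : m%:R = (m%:R : R)%:C :> R[i].
Proof. by rewrite rmorph_nat. Qed.

Lemma realCX (x : R) k : (x ^+ k)%:C = x%:C ^+ k :> R[i].
Proof. exact: rmorphXn. Qed.

Lemma nat_cpowN_real (m : nat) (s : R) : nat_cpowN m s%:C = (npow m s)%:C :> R[i].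
Proof.
rewrite /nat_cpowN /cexp /npow; apply/eqP; rewrite eq_complex; apply/andP; split; apply/eqP => /=;
by rewrite !(mul0r, mulr0, oppr0, subr0, addr0, add0r, cos0, sin0, mulr1) // mulNr mulrC mulNr.
Qed.

Lemma coordinate_value : phi (L (- 1)) = phi (- (\sum_(a < f) rho a * a%:R ^+ 2) / (2 * f%:R)).
Proof.
have [an dir] := hL.
have s0' : \sum_(a < f) phi (rho a) = 0 by rewrite -phi_sum s0.
have s1' : \sum_(a < f) phi (rho a) * a%:R = 0.
  rewrite -[RHS]phi0 -s1 phi_sum; apply: eq_bigr => a _; by rewrite natC phiZ.
have := @periodic_series_value R f (phi \o rho) f0 _ _ s0' s1' (fun s => phi (L s%:C)) _ _.
rewrite /= => h.
have -> : (- 1 : R[i]) = (- 1 : R)%:C by rewrite rmorphN1.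
rewrite h.
- have -> : (2 * f%:R)^-1 = ((2 * f%:R : R)^-1)%:C :> R[i] by rewrite fmorphV rmorphM !rmorph_nat.
  rewrite phiZ; congr (_ / _); rewrite -[LHS]sub0r -[X in phi X]sub0r phiB phi0; congr (_ - _).
  rewrite phi_sum; apply: eq_bigr => a _.
  have -> : a%:R ^+ 2 = ((a%:R : R) ^+ 2)%:C :> R[i] by rewrite natC -realCX.
  by rewrite phiZ.
- by move=> m; rewrite per.
- by rewrite rho0.
- move=> s; have [c [r [r0 hc]]] := an s%:C.
  exists (fun j => phi (c j)), r; split=> // t tr.
  have e : (s + t)%:C - s%:C = t%:C :> R[i] by rewrite rmorphD addrC addKr.
  have := hc (s + t)%:C; rewrite e => /(_ _) hs.
  have hs' := cvg_coordinate (hs _).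
  have : sums (fun j => phi (c j * t%:C ^+ j)) (phi (L (s + t)%:C)).
    apply: hs'; rewrite normc_def /= expr0n addr0 sqrtr_sqr ltcR //.
  by congr sums; apply/funext => j; rewrite -realCX phiZ.
- move=> s s_gt1; have := cvg_coordinate (dir s%:C s_gt1).
  congr sums; apply/funext => k; by rewrite nat_cpowN_real phiZ.
Qed.

End Coordinate.

(** [periodic_series_value] applied to the real and to the imaginary part. *)
Theorem dirichlet_L_value (R : realType) (g : int -> R[i]) (L : R[i] -> R[i]) (f : nat) :
  is_dirichlet_L (fun m : nat => g m%:Z) L -> (0 < f)%N ->
  has_period f g -> (forall a, g (- a) = g a) -> g 0 = 0 -> \sum_(a < f) g a%:Z = 0 ->
  L (- 1) = Lval f g.
Proof.
move=> hL f0 per ev g0 sg.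
have s1 := sum_mul_id_even per ev g0 sg.
have per' m : g (m + f)%N%:Z = g m%:Z by rewrite PoszD per.
apply/eqP; rewrite eq_complex; apply/andP; split; apply/eqP.
  apply: (coordinate_value (phi := @complex.Re R) _ _ _ hL) => //.
  - by move=> [a b] [c d].
  - by move=> [a b] r /=; rewrite mulr0 subr0.
  - exact: normc_ge_Re.
apply: (coordinate_value (phi := @complex.Im R) _ _ _ hL) => //.
- by move=> [a b] [c d].
- by move=> [a b] r /=; rewrite mulr0 add0r.
move=> x; have -> : `|x| = `|x * 'i%C| by rewrite normrM normCi mulr1.
by apply: le_trans (normc_ge_Re _); rewrite ReiNIm normrN.
Qed.

(** * Valuations above 2 *)

Section Algebraic.
Variable R : realType.
Implicit Types x y : R[i].

Lemma algebraicD x y : is_algebraic x -> is_algebraic y -> is_algebraic (x + y).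
Proof. exact: algebraic_add. Qed.
Lemma algebraicM x y : is_algebraic x -> is_algebraic y -> is_algebraic (x * y).
Proof. exact: algebraic_mul. Qed.
Lemma algebraicN x : is_algebraic x -> is_algebraic (- x).
Proof. exact: algebraic_opp. Qed.
Lemma algebraicV x : is_algebraic x -> is_algebraic x^-1.
Proof. exact: algebraic_inv. Qed.
Lemma algebraic_int (k : int) : is_algebraic (k%:~R : R[i]).
Proof. rewrite -(ratr_int _ k); exact: algebraic_id. Qed.
Lemma algebraic_root_of_unity x k : (0 < k)%N -> x ^+ k = 1 -> is_algebraic x.
Proof.
move=> k0 xk; exists ('X^k - 1).
  by rewrite -size_poly_eq0 size_XnsubC.
by rewrite rmorphB rmorph1 /= map_polyXn rootE !hornerE xk subrr.
Qed.
End Algebraic.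

Section Valuation.
Variables (R : realType) (v : R[i] -> \bar R).
Hypothesis hv : is_ord2 v.
Implicit Types (x y z : R[i]) (r s : R).
Local Notation alg := (@is_algebraic R).

Definition val_ge r x := alg x /\ (r%:E <= v x)%E.
Definition val_gt r x := alg x /\ (r%:E < v x)%E.
Definition val_eq r x := alg x /\ v x = r%:E.

Let vM x y : alg x -> alg y -> v (x * y) = (v x + v y)%E.
Proof. by case: hv => _ h _ _; apply: h. Qed.

Lemma val_zero : v 0 = +oo%E.
Proof.
case: hv => h _ _ _.
by have [_ [_ ->]] := h 0 (algebraic0 _).
Qed.

Let fin x : alg x -> x != 0 -> v x \is a fin_num.
Proof.
move=> ax x0; case: hv => /(_ x ax)[h1 h2] _ _ _.
by rewrite fin_numE h1; apply: contra_neq x0 => /h2.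
Qed.

Lemma val_one : v 1 = 0%E.
Proof.
have a1 : alg 1 := algebraic1 _.
have := vM a1 a1; rewrite mulr1; have := fin a1 (oner_neq0 _).
by case: (v 1) => // r _ [] /eqP; rewrite -subr_eq0 opprD addrA subrr add0r oppr_eq0 => /eqP ->.
Qed.

Lemma val_eq_one : val_eq 0 1.
Proof. by split; [exact: algebraic1 | exact: val_one]. Qed.

Lemma val_eq_two : val_eq 1 2%:R.
Proof. by split; [exact: (algebraic_int R 2) | case: hv]. Qed.

Lemma val_eqM r s x y : val_eq r x -> val_eq s y -> val_eq (r + s) (x * y).
Proof. by move=> [ax hx] [ay hy]; split; [exact: algebraicM | rewrite vM // hx hy]. Qed.

Lemma val_geM r s x y : val_ge r x -> val_ge s y -> val_ge (r + s) (x * y).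
Proof.
by move=> [ax hx] [ay hy]; split; [exact: algebraicM | rewrite vM // EFinD leeD].
Qed.

Lemma val_gtM r s x y : val_gt r x -> val_ge s y -> val_gt (r + s) (x * y).
Proof.
move=> [ax hx] [ay hy]; split; [exact: algebraicM | rewrite vM // EFinD].
by apply: lte_leD.
Qed.

Lemma val_geD r x y : val_ge r x -> val_ge r y -> val_ge r (x + y).
Proof.
move=> [ax hx] [ay hy]; split; [exact: algebraicD | case: hv => _ _ /(_ x y ax ay) h _].
by apply: le_trans h; rewrite le_min hx.
Qed.

Lemma val_gtD r x y : val_gt r x -> val_gt r y -> val_gt r (x + y).
Proof.
move=> [ax hx] [ay hy]; split; [exact: algebraicD | case: hv => _ _ /(_ x y ax ay) h _].
by apply: lt_le_trans h; rewrite lt_min hx.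
Qed.

Lemma val_gtW r x : val_gt r x -> val_ge r x.
Proof. by move=> [? /ltW]. Qed.

Lemma val_eq_ge r x : val_eq r x -> val_ge r x.
Proof. by move=> [? h]; split; rewrite ?h. Qed.

Lemma val_ge_gt r s x : s < r -> val_ge r x -> val_gt s x.
Proof. by move=> rs [? h]; split=> //; apply: lt_le_trans h; rewrite lte_fin. Qed.

Lemma val_eqN1 : val_eq 0 (- 1).
Proof.
have aN : alg (- 1) := algebraicN (algebraic1 _).
split=> //; have := vM aN aN; rewrite mulrNN mulr1 val_one.
have := fin aN; rewrite oppr_eq0 oner_neq0 => /(_ isT).
by case: (v _) => // r _ [] /eqP; rewrite -mulr2n eq_sym mulrn_eq0 /= => /eqP ->.
Qed.

Lemma val_geN r x : val_ge r x -> val_ge r (- x).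
Proof. by move=> h; rewrite -mulN1r -[r]add0r; apply: val_geM h; apply/val_eq_ge/val_eqN1. Qed.

Lemma val_gtN r x : val_gt r x -> val_gt r (- x).
Proof. by move=> h; rewrite -mulrN1 -[r]addr0; apply: val_gtM h _; apply/val_eq_ge/val_eqN1. Qed.

Lemma val_ge_zero r : val_ge r 0.
Proof. by split; [exact: algebraic0 | rewrite val_zero leey]. Qed.

Lemma val_gt_zero r : val_gt r 0.
Proof. by split; [exact: algebraic0 | rewrite val_zero ltry]. Qed.

Lemma val_ge_sum r (I : Type) (s : seq I) (P : pred I) (F : I -> R[i]) :
  (forall i, P i -> val_ge r (F i)) -> val_ge r (\sum_(i <- s | P i) F i).
Proof. by move=> h; elim/big_ind: _ => //; [exact: val_ge_zero | exact: val_geD]. Qed.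

Lemma val_gt_sum r (I : Type) (s : seq I) (P : pred I) (F : I -> R[i]) :
  (forall i, P i -> val_gt r (F i)) -> val_gt r (\sum_(i <- s | P i) F i).
Proof. by move=> h; elim/big_ind: _ => //; [exact: val_gt_zero | exact: val_gtD]. Qed.

Lemma val_ge_int (k : int) : val_ge 0 k%:~R.
Proof.
have hn (n : nat) : val_ge 0 n%:R.
  elim: n => [|n IH]; first exact: val_ge_zero.
  by rewrite -natr1; apply: val_geD => //; apply: val_eq_ge val_eq_one.
by case: k => n; rewrite ?NegzE ?rmorphN /=; [|apply: val_geN]; apply: hn.
Qed.

Lemma val_ge_even (k : int) : (2 %| k)%Z -> val_ge 1 k%:~R.
Proof.
move=> /dvdzP[m ->]; rewrite rmorphM -[1]add0r.
by apply: val_geM; [exact: val_ge_int | apply: val_eq_ge val_eq_two].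
Qed.

(** An element is determined up to valuation by any approximation of valuation exactly r
    with an error of valuation greater than r. *)
Lemma val_eq_close r x y : val_eq r y -> val_gt r (x - y) -> val_eq r x.
Proof.
move=> hy hxy; have ex : x = x - y + y by rewrite subrK.
have [ax gx] : val_ge r x by rewrite ex; apply: val_geD; [exact: val_gtW | exact: val_eq_ge].
split=> //; apply/eqP; rewrite eq_le gx andbT leNgt; apply/negP => lx.
have [_] : val_gt r y.
  have -> : y = x + - (x - y) by ring.
  by apply: val_gtD; [split | apply: val_gtN].
by rewrite hy.2 ltxx.
Qed.

Lemma val_eq_odd (k : int) : (k %% 2)%Z = 1 -> val_eq 0 k%:~R.
Proof.
move=> gM; apply: (val_eq_close val_eq_one).
apply: (@val_ge_gt 1) => //; rewrite -[1 in X in val_ge _ X]/(1%:~R) -rmorphB.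
by apply: val_ge_even; apply/dvdzP; exists (k %/ 2)%Z; lia.
Qed.

(** A multiple of the valuation of x is the valuation of 1. *)
Lemma val_eq_root_of_unity x k : (0 < k)%N -> x ^+ k = 1 -> val_eq 0 x.
Proof.
move=> k0 xk; have ax := algebraic_root_of_unity k0 xk; split=> //.
have x0 : x != 0.
  apply: contra_eq_neq xk => ->; rewrite expr0n; move: k0; rewrite lt0n => /negPf ->.
  by rewrite eq_sym oner_neq0.
have hX (j : nat) (r : R) : v x = r%:E -> v (x ^+ j) = (r *+ j)%:E.
  move=> vx; elim: j => [|j IH]; first by rewrite expr0 val_one.
  rewrite exprS vM // ?IH ?vx ?mulrS //.
  by elim: j {IH} => [|j IH]; [exact: algebraic1 | rewrite exprS; apply: algebraicM].
move: (fin ax x0); case e : (v x) => [r| |] // _.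
have := hX k r e; rewrite xk val_one => -[] /eqP.
by rewrite eq_sym mulrn_eq0 eqn0Ngt k0 /= => /eqP ->.
Qed.

(** The extension generated by a root of unity of order 2^(k+1) is totally ramified.
    By induction (1 - x)(1 + x) = 1 - x^2 has valuation 2^(1-k) at most 1, and the two
    factors differ by 2x of valuation 1, so unequal valuations would add up to more than
    that: the factors share it equally. *)
Lemma val_eq_one_sub x k : x ^+ (2 ^ k) = - 1 -> val_eq (2 ^- k) (1 - x).
Proof.
elim: k x => [|k IH] x hx.
  rewrite expn0 expr1 in hx; rewrite hx opprK expr0 invr1; exact: val_eq_two.
have /IH h2 : (x ^+ 2) ^+ (2 ^ k) = - 1 by rewrite -exprM -expnS.
have [ax vx] : val_eq 0 x.
  apply: (@val_eq_root_of_unity _ (2 ^ k.+1 * 2)); first by rewrite muln_gt0 expn_gt0.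
  by rewrite exprM hx sqrrN expr1n.
have am : alg (1 - x) by apply: algebraicD; [exact: algebraic1 | exact: algebraicN].
have ap : alg (1 + x) by apply: algebraicD; [exact: algebraic1 | ].
have e : 1 - x ^+ 2 = (1 - x) * (1 + x) by ring.
have [_ h] := h2; rewrite e vM // in h.
have h21 : (2 ^- k : R) <= 1 by rewrite invf_le1 ?exprn_gt0 // exprn_ege1 // ler1n.
have hs : (2 ^- k : R) = 2 * 2 ^- k.+1 by rewrite exprS invfM mulrA divff ?mul1r ?pnatr_eq0.
have p0 : 0 < (2 ^- k : R) by rewrite invr_gt0 exprn_gt0.
split=> //.
have [v2a v2] : val_eq 1 (2%:R * x) by rewrite -[1]addr0; apply: val_eqM; [exact: val_eq_two|].
have h1 : (Order.min (v (1 + x)%R) (v (1 - x)%R) <= 1)%E.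
  rewrite leNgt lt_min; apply/negP => /andP[g1 g2].
  have [_] : val_gt 1 (2%:R * x).
    have -> : 2%:R * x = 1 + x + - (1 - x) by ring.
    by apply: val_gtD; [split | apply: val_gtN].
  by rewrite v2 ltxx.
have hp : (Order.min (v (1 - x)%R) 1 <= v (1 + x)%R)%E.
  have -> : 1 + x = (1 - x) + 2%:R * x by ring.
  by case: hv => _ _ hm _; rewrite -v2; apply: hm.
have hm : (Order.min (v (1 + x)%R) 1 <= v (1 - x)%R)%E.
  have -> : 1 - x = (1 + x) + - (2%:R * x) by ring.
  have [aN vN] : val_eq 1 (- (2%:R * x)).
    by rewrite -mulN1r -[1]add0r; apply: val_eqM val_eqN1 _.
  by case: hv => _ _ hm _; rewrite -vN; apply: hm.
move: h hp hm; case e1 : (v (1 - x)) => [r1| |]; case e2 : (v (1 + x)) => [r2| |] //.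
rewrite -EFinD => -[h] ; rewrite -!EFin_min !lee_fin !ge_min => /orP h3 /orP h4.
by congr (_%:E); case: h3; case: h4 => *; lra.
Qed.
End Valuation.

(** * Characters of the cyclotomic Z_2-extension *)

Section Character.
Variables (R : realType) (n : nat) (chi : int -> R[i]).
Hypothesis hchi : cyclotomic_Z2_character n chi.

Let N := (2 ^ (n + 2))%N.

Lemma chi_dirichlet : dirichlet_character N chi.
Proof. by case: hchi. Qed.

Lemma chi_periodic : has_period N chi.
Proof. by case: chi_dirichlet. Qed.

Lemma chiM a b : chi (a * b) = chi a * chi b.
Proof. by case: chi_dirichlet => _ h _; apply: h. Qed.

Lemma coprimez_odd a : coprimez a N%:Z = ((a %% 2)%Z == 1).
Proof.
have -> : coprimez a N%:Z = coprime `|a| N by [].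
by rewrite coprime_pexpr ?addn2 // coprimen2; lia.
Qed.

Lemma chi_neq0 a : (chi a != 0) = ((a %% 2)%Z == 1).
Proof. by case: chi_dirichlet => _ _ ->; rewrite coprimez_odd. Qed.

Lemma chi_even a : (a %% 2)%Z != 1 -> chi a = 0.
Proof. by rewrite -chi_neq0 negbK => /eqP. Qed.

Lemma chi1 : chi 1 = 1.
Proof.
have c0 : chi 1 != 0 by rewrite chi_neq0.
by apply: (mulfI c0); rewrite -chiM !mulr1.
Qed.

Lemma chiN a : chi (- a) = chi a.
Proof. by case: hchi => _ hN _ _; rewrite -mulN1r chiM hN mul1r. Qed.

Lemma chiX a k : chi (a ^+ k) = chi a ^+ k.
Proof. by elim: k => [|k IH]; rewrite ?chi1 // !exprS chiM IH. Qed.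

Lemma chi_expr a : (a %% 2)%Z = 1 -> chi a ^+ (2 ^ n) = 1.
Proof.
move=> ha; case: hchi => _ _ _ /(_ (2 ^ n)%N)[_ h].
by apply: h => //; rewrite coprimez_odd ha.
Qed.

Lemma chi_addM a (k : int) : chi (a + N%:Z * k) = chi a.
Proof.
have hp (m : nat) b : chi (b + N%:Z * m%:Z) = chi b.
  by rewrite -PoszM mulnC; apply: has_periodM chi_periodic _ _.
case: k => m; first exact: hp.
by rewrite NegzE -[LHS](hp m.+1) mulrN subrK.
Qed.

(** The kernel of reduction modulo N/2 has the single nontrivial element 1 + N/2, of
    order 2, on which a primitive character cannot be trivial. *)
Lemma chi_half u : (u %% 2)%Z = 1 -> chi (1 + (2 ^ n.+1)%N%:Z * u) = - 1.
Proof.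
move=> hu; have NE : N%:Z = (2 ^ n.+1)%N%:Z * 2 by rewrite /N addn2 [in LHS]expnS PoszM mulrC.
have key w : (w %% 2)%Z = 1 -> chi (1 + (2 ^ n.+1)%N%:Z * w) = chi (1 + (2 ^ n.+1)%N%:Z).
  move=> hw; rewrite -[RHS](chi_addM _ (w %/ 2)%Z); congr chi; rewrite NE.
  rewrite [in LHS](divz_eq w 2) hw; move: (2 ^ n.+1)%N%:Z (w %/ 2)%Z => M t; ring.
rewrite key //; set b := chi _.
have b2 : b ^+ 2 == 1 ^+ 2.
  rewrite -chiX expr1n -chi1 -(chi_addM 1 (1 + (2 ^ n)%N%:Z)); apply/eqP; congr chi.
  rewrite NE expnS PoszM; move: (2 ^ n)%N%:Z => M; ring.
move: b2; rewrite eqf_sqr => /orP[/eqP b1|/eqP //].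
case: hchi => _ _ hprim _.
have [||a [ha /dvdzP[w hw] /negP]] := hprim (2 ^ n.+1)%N.
- by apply: dvdn_exp2l; rewrite addn2.
- by rewrite ltn_exp2l // addn2.
case; apply/eqP; have -> : a = 1 + (2 ^ n.+1)%N%:Z * w by rewrite mulrC -hw addrC subrK.
have : (w %% 2)%Z = 1 \/ (w %% 2)%Z = 0 by lia.
case=> hw2; first by rewrite key.
rewrite (divz_eq w 2) hw2 addr0 (mulrC _ 2) mulrA -NE chi_addM chi1 //.
Qed.

(** Squaring 1 + 4 2^f u with u odd increases f by one and keeps u odd, which leads to
    [chi_half]. *)
Lemma chi_pow k f u : (u %% 2)%Z = 1 -> (f + k).+1 = n ->
  chi (1 + 4 * 2 ^+ f * u) ^+ (2 ^ k) = - 1.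
Proof.
elim: k f u => [|k IH] f u hu fk.
  rewrite expn0 expr1 -(chi_half hu); congr (chi (1 + _ * u)).
  rewrite -fk addn0 !expnS mulnA PoszM; congr (_ * _).
  by rewrite -[RHS]natz natrX.
rewrite expnS exprM -chiX.
have -> : (1 + 4 * 2 ^+ f * u) ^+ 2 = 1 + 4 * 2 ^+ f.+1 * (u * (1 + 2 * (2 ^+ f * u))).
  by rewrite [2 ^+ f.+1]exprS; move: (2 ^+ f) => t; ring.
apply: IH; last by rewrite -fk addnS.
rewrite -modzMm hu mul1r.
have -> : ((1 + 2 * (2 ^+ f * u)) %% 2)%Z = 1 by move: (2 ^+ f * u) => w; lia.
by [].
Qed.

End Character.

Section CharacterValuation.
Variables (R : realType) (v : R[i] -> \bar R) (n : nat) (chi : int -> R[i]).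
Hypothesis hv : is_ord2 v.
Hypothesis hchi : cyclotomic_Z2_character n chi.

Lemma val_gt_sub_one (x : R[i]) k : x ^+ (2 ^ k) = 1 -> val_gt v 0 (x - 1).
Proof.
elim: k => [|k IH]; first by rewrite expn0 expr1 => ->; rewrite subrr; apply: val_gt_zero.
rewrite expnSr exprM => /eqP; rewrite -[X in _ == X](expr1n _ 2) eqf_sqr.
case/orP=> [/eqP /IH //|/eqP hx].
rewrite -opprB; apply: val_gtN => //.
have := val_eq_one_sub hv hx; move/val_eq_ge; apply: val_ge_gt.
by rewrite invr_gt0 exprn_gt0.
Qed.

Lemma chi_val_ge a : val_ge v 0 (chi a).
Proof.
case: (eqVneq ((a %% 2)%Z) 1) => ha; last by rewrite (chi_even hchi) //; apply: val_ge_zero.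
apply: val_eq_ge; apply: (val_eq_root_of_unity hv _ (chi_expr hchi ha)).
by rewrite expn_gt0.
Qed.

Lemma chi_val_gt a : (a %% 2)%Z = 1 -> val_gt v 0 (chi a - 1).
Proof. by move=> ha; apply: val_gt_sub_one (chi_expr hchi ha). Qed.

(** For odd c the difference is a multiple of 2, hence of valuation at least 1. *)
Lemma val_gt_twist_factor x (c : int) k : val_ge v 0 x -> (c %% 2)%Z = 1 ->
  val_gt v (2 ^- k.+1) (1 - x * c%:~R - (1 - x)).
Proof.
move=> gx hc.
have -> : 1 - x * c%:~R - (1 - x) = (1 - c)%:~R * x by rewrite rmorphB /=; ring.
rewrite -[2 ^- k.+1]addr0; apply: (val_gtM hv) => //.
apply: (@val_ge_gt _ _ 1); last first.
  by apply: (val_ge_even hv); apply/dvdzP; exists ((1 - c) %/ 2)%Z; lia.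
by rewrite invf_lt1 ?exprn_gt0 // exprn_egt1 // ltr1n.
Qed.

Lemma val_eq_twist_factor x (c : int) k : x ^+ (2 ^ k.+1) = - 1 -> val_ge v 0 x -> (c %% 2)%Z = 1 ->
  val_eq v (2 ^- k.+1) (1 - x * c%:~R).
Proof.
move=> hx gx hc; apply: (val_eq_close hv (val_eq_one_sub hv hx)).
exact: val_gt_twist_factor.
Qed.

Lemma val_ge_div r s (x y : R[i]) : val_eq v r x -> val_ge v (r + s) (x * y) ->
  val_ge v s y.
Proof.
move=> [ax vx] [axy vxy].
have x0 : x != 0 by apply: contra_eq_neq vx => ->; rewrite (val_zero hv).
have ay : is_algebraic y by rewrite -(mulKf x0 y); apply: algebraicM => //; apply: algebraicV.
split=> //; move: vxy; case: (hv) => _ -> // _ _.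
by rewrite vx EFinD leeD2lE.
Qed.

Lemma val_eq_div r s (x y : R[i]) : val_eq v r x -> val_eq v (r + s) (x * y) ->
  val_eq v s y.
Proof.
move=> hx [axy vxy].
have [ay _] : val_ge v s y by apply: (val_ge_div hx); split=> //; rewrite vxy.
split=> //; move: vxy; case: hx => ax vx; case: (hv) => _ -> // _ _.
rewrite vx; case: (v y) => [t| |] //; rewrite -EFinD => -[] /addrI -> //.
Qed.

Definition twist (h : int -> int) (a : int) : R[i] := chi a * (h a)%:~R.

Lemma val_ge_twist h a : val_ge v 0 (twist h a).
Proof.
by rewrite -[0]addr0; apply: (val_geM hv); [exact: chi_val_ge | exact: val_ge_int].
Qed.

Lemma twist_even h (b : nat) : ~~ odd b -> twist h b%:Z = 0.
Proof. by move=> hb; rewrite /twist (chi_even hchi) ?mul0r //; lia. Qed.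

Section Twist.
Variables (d : nat) (h : int -> int).
Hypothesis n2 : (2 <= n)%N.
Hypotheses (d2 : odd d).
Hypothesis hper : forall a k, h (a + 4 * d%:Z * k) = h a.
Hypothesis hN : forall a, (a %% 2)%Z = 1 -> h (- a) = h a.

Let d0 : (0 < d)%N. Proof. by case: d d2. Qed.

Lemma twist_periodic : has_period (2 ^ (n + 2) * d) (twist h).
Proof.
move=> a; rewrite /twist; congr (_ * _%:~R).
  by rewrite mulnC has_periodM //; apply: chi_periodic.
rewrite addn2 !expnS mulnA mulnAC PoszM hper //.
Qed.

Lemma twistN a : twist h (- a) = twist h a.
Proof.
rewrite /twist (chiN hchi); case: (eqVneq ((a %% 2)%Z) 1) => ha; first by rewrite hN.
by rewrite (chi_even hchi) // !mul0r.
Qed.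

Lemma coprime_twist : coprime (4 * d).+1 (2 ^ (n + 2) * d).
Proof.
rewrite coprimeMr coprime_pexpr ?addn2 // coprimen2 /= oddM /=.
by rewrite -addn1 coprime_sym /coprime gcdnMDl gcdn1.
Qed.

Lemma twist_mul (b : nat) :
  twist h ((4 * d).+1 * b)%N%:Z = chi (4 * d).+1%:Z * twist h b%:Z.
Proof.
rewrite /twist PoszM (chiM hchi) mulrA; congr (_ * _%:~R).
by rewrite -(hper b%:Z b%:Z) intS PoszM mulrDl mul1r.
Qed.

(** The number 1 + 4d is 5 modulo 8, and it is 1 modulo 4d. *)
Lemma chi_generator : chi (4 * d).+1%:Z ^+ (2 ^ n.-1) = - 1.
Proof.
rewrite intS PoszM -[4%N%:Z]/(4 * 2 ^+ 0 : int); apply: (chi_pow hchi); first by lia.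
by rewrite add0n prednK // (leq_trans _ n2).
Qed.

Lemma twist_sum : \sum_(a < 2 ^ (n + 2) * d) twist h a%:Z = 0.
Proof.
apply: (sum_twist_eq0 _ coprime_twist twist_periodic twist_mul).
  by rewrite muln_gt0 expn_gt0.
apply/eqP => e; have := chi_generator; rewrite e expr1n => /eqP.
by rewrite -subr_eq0 opprK -(natrD _ 1 1) pnatr_eq0.
Qed.

(** [fold_identity] for the multiplier 1 + 4d, which fixes h: the right-hand side is
    twice an integral element, and 1 - chi(c) c^2 has valuation 2^(1-n). *)
Lemma val_ge_Lval : val_ge v (1 - 2 ^- n.-1) (Lval (2 ^ (n + 2) * d) (twist h)).
Proof.
have F0 : (0 < 2 ^ n * d)%N by rewrite muln_gt0 expn_gt0.
have NE : (2 ^ (n + 2) * d = (2 ^ n * d).*2.*2)%N.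
  by rewrite addn2 !expnS -!mul2n !mulnA.
have := coprime_twist; have := twist_periodic; rewrite NE => per cop.
have ce : (4 * d).+1 = d.*2.*2.+1 by lia.
have n1 : n.-1 = n.-2.+1 by lia.
have gM : chi (4 * d).+1%:Z ^+ (2 ^ n.-2.+1) = -1 by rewrite -n1 chi_generator.
have e := fold_identity F0 cop per ce twist_mul twistN (twist_even h).
have vk : val_eq v (2 ^- n.-1) (1 - chi (4 * d).+1%:Z * (4 * d).+1%:R ^+ 2).
  have -> : (4 * d).+1%:R ^+ 2 = ((4 * d).+1%:Z ^+ 2)%:~R :> R[i] by rewrite rmorphXn.
  rewrite n1; apply: val_eq_twist_factor => //; first exact: chi_val_ge.
  by rewrite expr2 -modzMm; have -> : ((4 * d).+1%:Z %% 2)%Z = 1 by lia.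
apply: (val_ge_div vk); rewrite addrC subrK e.
rewrite -mulrA -[1]addr0; apply: (val_geM hv); first by apply: val_eq_ge; apply: val_eq_two.
rewrite -[0]addr0; apply: (val_geM hv); first exact: chi_val_ge.
have vn m : val_ge v 0 (m%:R : R[i]) by apply: (val_ge_int hv m%:Z).
apply: (val_geD hv).
  rewrite -[0]addr0; apply: (val_geM hv) => //; apply: (val_ge_sum hv) => i _.
  by rewrite -[0]addr0; apply: (val_geM hv); [exact: val_ge_twist | exact: val_ge_int].
apply: (val_geN hv); rewrite -[0]addr0; apply: (val_geM hv) => //; apply: (val_ge_sum hv) => i _.
rewrite -[0]addr0; apply: (val_geM hv); first exact: val_ge_twist.
by rewrite -natrX; apply: vn.
Qed.

End Twist.
End CharacterValuation.

Lemma three_ndvd_pow2 k : ~~ (3 %| 2 ^ k)%N.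
Proof. by rewrite Euclid_dvdX. Qed.

Lemma sum_geq m t : (t <= m)%N -> (\sum_(i < m) (t <= i) = m - t)%N.
Proof.
elim: m => [|m IH]; first by rewrite leqn0 => /eqP->; rewrite big_ord0.
rewrite leq_eqVlt big_ord_recr /= => /orP[/eqP -> |]; last first.
  by rewrite ltnS => tm; rewrite IH // tm; lia.
rewrite ltnn addn0 subnn big1 // => i _; have := ltn_ord i; lia.
Qed.

Lemma sum_third (M t : nat) : t = ((2 * M + 1) %/ 3)%N ->
  (\sum_(i < M) (3 * i.*2.+1 %/ M.*2.*2) = M - t)%N.
Proof.
move=> ht; rewrite -(@sum_geq M t); last by lia.
apply: eq_bigr => -[i lt_i] _ /=.
case: (leqP t i) => ti /=; last by rewrite divn_small //; lia.
have -> : (3 * i.*2.+1 = 1 * M.*2.*2 + (3 * i.*2.+1 - M.*2.*2))%N by lia.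
by rewrite divnMDl ?divn_small //; lia.
Qed.

(** With M = 2^n, the quotient of 3(2i+1) by 4M is 0 or 1 for i < M, and it is 1 from
    i = t on, where t is the integral part of (2M+1)/3; t is odd since 3 does not divide 2M. *)
Lemma odd_sum_third n : (1 <= n)%N ->
  odd (\sum_(i < 2 ^ n) (3 * i.*2.+1 %/ (2 ^ n).*2.*2))%N.
Proof.
move=> n1; rewrite (sum_third erefl).
have := three_ndvd_pow2 n.+1.
have : ~~ odd (2 ^ n) by rewrite oddX orbF; case: n n1.
rewrite expnS; move: (2 ^ n)%N => M; lia.
Qed.

Section TrivialTwist.
Variables (R : realType) (v : R[i] -> \bar R) (n : nat) (chi : int -> R[i]).
Hypothesis hv : is_ord2 v.
Hypothesis hchi : cyclotomic_Z2_character n chi.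
Hypothesis n2 : (2 <= n)%N.

Lemma chi_three : chi 3 ^+ (2 ^ n.-1) = - 1.
Proof.
rewrite -(chiN hchi) -[- 3]/(1 + 4 * 2 ^+ 0 * (- 1) : int); apply: (chi_pow hchi) => //.
by rewrite add0n prednK // (leq_trans _ n2).
Qed.

(** [fold_identity] for the multiplier 3, with period N = 2^(n+2).  Modulo the maximal
    ideal chi is 1 on odd integers and the weights reduce to the quotients of 3b by N
    plus 1, whose sum is odd by [odd_sum_third]. *)
Lemma val_eq_Lval_chi : val_eq v (1 - 2 ^- n.-1) (Lval (2 ^ (n + 2)) chi).
Proof.
have F0 : (0 < 2 ^ n)%N by rewrite expn_gt0.
have NE : (2 ^ (n + 2) = (2 ^ n).*2.*2)%N.
  by rewrite addn2 !expnS -!mul2n.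
have := chi_periodic hchi.
have cop : coprime 3 (2 ^ (n + 2)) by rewrite coprimeXr.
move: cop; rewrite NE => cop per.
have n1 : n.-1 = n.-2.+1 by lia.
have gM (b : nat) : chi (3 * b)%N%:Z = chi 3 * chi b%:Z by rewrite PoszM (chiM hchi).
have ev (b : nat) : ~~ odd b -> chi b%:Z = 0.
  by move=> hb; rewrite (chi_even hchi) //; lia.
have e := @fold_identity _ _ _ 1 _ _ F0 cop per erefl gM (chiN hchi) ev.
have vk : val_eq v (2 ^- n.-1) (1 - chi 3 * 3%:R ^+ 2).
  have -> : 3%:R ^+ 2 = (9 : int)%:~R :> R[i] by ring.
  rewrite n1; apply: val_eq_twist_factor => //; last exact: (chi_val_ge hv hchi).
  by rewrite -n1 chi_three.
apply: (val_eq_div hv vk); rewrite addrC subrK e.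
rewrite -mulrA -[1]addr0; apply: (val_eqM hv); first exact: val_eq_two.
rewrite -[0]addr0; apply: (val_eqM hv).
  apply: (@val_eq_root_of_unity _ _ hv _ (2 ^ n)); first by rewrite expn_gt0.
  exact: (chi_expr hchi).
have vn m : val_ge v 0 (m%:R : R[i]) by apply: (val_ge_int hv m%:Z).
set w := fold_weight _ _ _.
have hw : ((\sum_(i < 2 ^ n) w i.*2.+1) %% 2)%Z = 1.
  have hwq (i : nat) : exists t, w i.*2.+1 = (3 * i.*2.+1 %/ (2 ^ n).*2.*2)%N%:Z + 1 + 2 * t.
    rewrite /w /fold_weight; set q := (_ %/ _)%N.
    (* with b = 2i + 1 and N = 4 2^n all of the weight but q + 1 is even *)
    exists (i%:Z * q%:Z + (2 ^ n).*2%:Z - i%:Z - 1 - (2 ^ n)%N%:Z * q%:Z).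
    have -> : i.*2.+1%:Z = 2 * i%:Z + 1 by lia.
    have -> : (2 ^ n).*2.*2%:Z = 2 * (2 ^ n).*2%:Z by lia.
    have -> : (2 ^ n).*2%:Z = 2 * (2 ^ n)%N%:Z by lia.
    move: (2 ^ n)%N%:Z => m; ring.
  have [t ht] := choice hwq.
  under eq_bigr do rewrite ht.
  rewrite !big_split /= -mulr_sumr sumr_const card_ord natz.
  have := odd_sum_third (ltnW n2).
  rewrite -[X in odd X]/(absz (Posz _)) (big_morph Posz PoszD (id1 := 0)) //.
  have : ~~ odd (2 ^ n) by rewrite oddX /=; case: n n2.
  move: (2 ^ n)%N => m; move: (\sum_(i < m) Posz _) (\sum_(i < m) t i) => a b.
  lia.
apply: (val_eq_close hv (val_eq_odd hv hw)).
clearbody w; set T := \sum_(i < 2 ^ n) chi _ * _; set S := \sum_(b < (2 ^ n).*2.*2) chi _ * _.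
have -> : 3%:R * T - (2 ^ n)%:R * S - (\sum_(i < 2 ^ n) w i.*2.+1)%:~R =
    2%:R * T - (2 ^ n)%:R * S + \sum_(i < 2 ^ n) (chi i.*2.+1%:Z - 1) * (w i.*2.+1)%:~R.
  under [in RHS]eq_bigr do rewrite mulrBl mul1r.
  by rewrite sumrB -rmorph_sum /= -/T; ring.
have even_gt m (x : R[i]) : (2 %| m)%N -> val_ge v 0 x -> val_gt v 0 (m%:R * x).
  move=> m2 hx; apply: (@val_ge_gt _ _ 1) => //; rewrite -[1]addr0; apply: (val_geM hv) => //.
  by apply: (val_ge_even hv (k := m%:Z)).
apply: (val_gtD hv); first apply: (val_gtD hv).
- apply: even_gt => //; apply: (val_ge_sum hv) => i _.
  by rewrite -[0]addr0; apply: (val_geM hv); [exact: (chi_val_ge hv hchi) | exact: val_ge_int].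
- apply: (val_gtN hv); apply: even_gt; first by rewrite Euclid_dvdX //; case: n n2.
  apply: (val_ge_sum hv) => i _; rewrite -[0]addr0.
  apply: (val_geM hv); first exact: (chi_val_ge hv hchi).
  by rewrite -natrX; apply: vn.
- apply: (val_gt_sum hv) => i _; rewrite -[0]addr0; apply: (val_gtM hv).
    by apply: (chi_val_gt hv hchi); lia.
  exact: val_ge_int.
Qed.

End TrivialTwist.

(** * Leading terms of L-values with several Euler factors *)

Section LeadingTerms.
Variables (R : realType) (v : R[i] -> \bar R).
Hypothesis hv : is_ord2 v.

(** Congruence of x and y modulo elements of larger valuation than y.  Unlike equality
    of valuations it can be summed, which the induction on the set of primes needs. *)
Definition same_lead (r : R) (x y : R[i]) := val_eq v r y /\ val_gt v r (x - y).

Lemma same_leadM r s x y x' y' : same_lead r x y -> same_lead s x' y' ->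
  same_lead (r + s) (x * x') (y * y').
Proof.
move=> [hy hx] [hy' hx']; split; first exact: (val_eqM hv).
have -> : x * x' - y * y' = (x - y) * x' + (x' - y') * y by ring.
apply: (val_gtD hv).
  by apply: (val_gtM hv) => //; apply: val_eq_ge; apply: (val_eq_close hv hy').
by rewrite addrC; apply: (val_gtM hv) => //; apply: val_eq_ge.
Qed.

Lemma same_lead_refl r x : val_eq v r x -> same_lead r x x.
Proof. by move=> h; split=> //; rewrite subrr; apply: val_gt_zero. Qed.

Lemma same_lead_prod (I : finType) (A : {set I}) (r : I -> R) (x y : I -> R[i]) :
  (forall i, i \in A -> same_lead (r i) (x i) (y i)) ->
  same_lead (\sum_(i in A) r i) (\prod_(i in A) x i) (\prod_(i in A) y i).
Proof.
move=> h.
apply: (big_rec3 (fun a b c => same_lead a b c)).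
  by apply: same_lead_refl; exact: (val_eq_one hv).
by move=> i a b c /h hi hbc; apply: same_leadM.
Qed.
End LeadingTerms.

Lemma dvdz_add_mul4 (p : nat) (a k : int) : (p%:Z %| a + 4 * p%:Z * k)%Z = (p%:Z %| a)%Z.
Proof. by rewrite [LHS]rpredDr // mulrAC dvdz_mull. Qed.

Section SeveralPrimes.
Variables (R : realType) (v : R[i] -> \bar R) (n : nat) (chi : int -> R[i]).
Hypothesis hv : is_ord2 v.
Hypothesis hchi : cyclotomic_Z2_character n chi.
Hypothesis n2 : (2 <= n)%N.
Variables (I : finType) (p : I -> nat).
Hypotheses (pp : forall i, prime (p i)) (p2 : forall i, odd (p i)) (pinj : injective p).
Hypothesis pn : forall i, (f2 (p i) + 2 <= n)%N.

Implicit Types (T Q U : {set I}) (i : I).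

(** The factor at p is psi_p for i in T and the trivial character modulo p for i in Q;
    T marks the primes of the conductor and Q the Euler factors to be removed. *)
Definition mixed_factor (T Q : {set I}) (i : I) (a : int) : int :=
  (if i \in T then psi_prime (p i) a else 1) * (if i \in Q then (~~ (p i %| a)%Z)%:R else 1).

Definition mixed_char (T Q : {set I}) (a : int) : int := \prod_i mixed_factor T Q i a.

Lemma mixed_charD (T Q : {set I}) (d : nat) :
  (forall i, (i \in T) || (i \in Q) -> (p i %| d)%N) ->
  forall a k, mixed_char T Q (a + 4 * d%:Z * k) = mixed_char T Q a.
Proof.
move=> hd a k; apply: eq_bigr => i _; rewrite /mixed_factor.
have H : (p i %| d)%N -> psi_prime (p i) (a + 4 * d%:Z * k) = psi_prime (p i) a /\
    (p i %| a + 4 * d%:Z * k)%Z = (p i %| a)%Z.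
  move=> /dvdnP[m ->]; have -> : 4 * (m * p i)%N%:Z * k = 4 * (p i)%:Z * (m%:Z * k).
    by rewrite PoszM; ring.
  by rewrite psi_primeD // dvdz_add_mul4.
case iT : (i \in T); case iQ : (i \in Q) => //;
  by have [|e1 e2] := H _; [apply: hd; rewrite iT ?iQ ?orbT | rewrite ?e1 ?e2].
Qed.

Lemma mixed_charN T Q a : (a %% 2)%Z = 1 -> mixed_char T Q (- a) = mixed_char T Q a.
Proof.
move=> ha; apply: eq_bigr => i _; rewrite /mixed_factor psi_primeN //.
by rewrite (_ : (p i %| - a)%Z = (p i %| a)%Z) // !dvdzE abszN.
Qed.

Lemma mixed_charM T Q a b : (a %% 2)%Z = 1 -> (b %% 2)%Z = 1 ->
  mixed_char T Q (a * b) = mixed_char T Q a * mixed_char T Q b.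
Proof.
move=> ha hb; rewrite -big_split; apply: eq_bigr => i _; rewrite /mixed_factor psi_primeM //=.
have -> : (p i %| a * b)%Z = (p i %| a)%Z || (p i %| b)%Z.
  by rewrite !dvdzE abszM (Euclid_dvdM _ _ (pp i)).
by do 2 case: ifP => _; do 2 case: (_ %| _)%Z; rewrite /= ?mulr0 ?mul0r ?mulr1 ?mul1r.
Qed.

Lemma mixed_char_prime T Q i : i \notin T -> i \notin Q ->
  mixed_char T Q (p i)%:Z = mixed_char T set0 (p i)%:Z.
Proof.
move=> iT iQ; apply: eq_bigr => j _; rewrite /mixed_factor in_set0.
case: (boolP (j \in Q)) => // jQ; suff -> : (p j %| (p i)%:Z)%Z = false by [].
rewrite -[(_ %| _)%Z]/(p j %| p i)%N dvdn_prime2 //; apply/eqP => /pinj e.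
by move: iQ; rewrite -e jQ.
Qed.

Let d := (\prod_i p i)%N.
Let d2 : odd d. Proof. by rewrite /d; elim/big_ind: _ => // x y hx hy; rewrite oddM hx. Qed.
Let pd i : (p i %| d)%N. Proof. by rewrite /d (bigD1 i) //= dvdn_mulr. Qed.

Definition imprimitive_L T Q := Lval (2 ^ (n + 2) * d) (twist chi (mixed_char T Q)).

(** The function attached to T and Q already has period 2^(n+2) d / p, and adding p to Q
    restricts it to the integers prime to p, so [Lval_euler] applies. *)
Lemma imprimitive_L_setU1 T Q i : i \notin T -> i \notin Q ->
  imprimitive_L T (i |: Q) =
  (1 - chi (p i)%:Z * (mixed_char T set0 (p i)%:Z * (p i)%:Z)%:~R) * imprimitive_L T Q.
Proof.
move=> iT iQ; rewrite /imprimitive_L.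
pose d' := (\prod_(j | j != i) p j)%N.
have de : d = (d' * p i)%N by rewrite /d (bigD1 i) //= mulnC.
have d'2 : odd d' by move: d2; rewrite de oddM => /andP[].
have hd' j : (j \in T) || (j \in Q) -> (p j %| d')%N.
  move=> hj; have ji : j != i by apply: contraTneq hj => ->; rewrite negb_or iT.
  by rewrite /d' (bigD1 j) //= dvdn_mulr.
have per' := mixed_charD hd'.
rewrite (_ : twist chi (mixed_char T (i |: Q)) =
   fun a => if ((p i)%:Z %| a)%Z then 0 else twist chi (mixed_char T Q) a); last first.
  apply/funext => a; rewrite /twist /mixed_char (bigD1 i) //= [in RHS](bigD1 i) //=.
  rewrite /mixed_factor (negPf iT) (negPf iQ) !inE eqxx /= !mul1r.
  case: ifP => /= _; rewrite ?mul0r ?mulr0 ?mul1r //.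
  congr (_ * _%:~R); apply: eq_bigr => j /negPf ji; by rewrite !inE ji.
rewrite de mulnA Lval_euler //.
- by rewrite /twist mixed_char_prime // intrM [chi _ * (_ * _)]mulrA.
- exact: prime_gt0.
- by rewrite muln_gt0 expn_gt0 (odd_gt0 d'2).
- exact: (twist_periodic hchi per').
- exact: (twistN hchi (@mixed_charN T Q)).
- by rewrite /twist (chi_even hchi) ?mul0r.
- exact: (twist_sum hchi n2 d'2 per').
- move=> b; rewrite /twist PoszM (chiM hchi).
  case: (boolP (odd b)) => hb; last by rewrite (chi_even hchi) ?mul0r //; lia.
  rewrite mixed_charM //; [by rewrite rmorphM /= mulrACA | by lia |].
  by have := p2 i; lia.
Qed.

Lemma imprimitive_L_factor T Q : [disjoint T & Q] ->
  imprimitive_L T Q =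
  (\prod_(i in Q) (1 - chi (p i)%:Z * (mixed_char T set0 (p i)%:Z * (p i)%:Z)%:~R))
  * imprimitive_L T set0.
Proof.
move: {2}#|Q| (leqnn #|Q|) => m; elim: m Q => [|m IH] Q.
  by rewrite leqn0 cards_eq0 => /eqP -> _; rewrite big_set0 mul1r.
have [->|[i iQ]] := set_0Vmem Q; first by rewrite big_set0 mul1r.
rewrite (cardsD1 i) iQ add1n ltnS => hm dis.
have iT : i \notin T by apply: contraTN iQ => iT; rewrite (disjointFr dis iT).
rewrite -(setD1K iQ) imprimitive_L_setU1 ?setD11 // IH //; last first.
  by apply: disjointWr dis; exact: subsetDl.
by rewrite big_setU1 ?setD11 //= mulrA.
Qed.

Definition euler_val i : R := 2 ^- (n.-1 - f2 (p i)).
Definition expected_val (T : {set I}) : R := 1 - 2 ^- n.-1 + \sum_(i in T) euler_val i.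
Definition lead_term (T : {set I}) := Lval (2 ^ (n + 2)) chi * \prod_(i in T) (1 - chi (p i)%:Z).

(** chi is even, so p may be replaced by p^* = 1 + 4 2^(f_p) u. *)
Lemma chi_prime i : chi (p i)%:Z ^+ (2 ^ (n.-1 - f2 (p i))) = - 1.
Proof.
have -> : chi (p i)%:Z = chi (pstar (p i)).
  rewrite /pstar legendreN1 // -signr_odd; case: odd; rewrite ?expr0 ?mul1r //.
  by rewrite expr1 mulN1r (chiN hchi).
have [u hu ->] := pstar_decomp (pp i) (p2 i).
by apply: (chi_pow hchi hu); have := pn i; lia.
Qed.

Lemma lead_factor i (e : int) : (e %% 2)%Z = 1 ->
  same_lead v (euler_val i) (1 - chi (p i)%:Z * (e * (p i)%:Z)%:~R) (1 - chi (p i)%:Z).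
Proof.
move=> he; split; first exact: (val_eq_one_sub hv (chi_prime i)).
have -> : euler_val i = 2 ^- (n.-2 - f2 (p i)).+1.
  by rewrite /euler_val; congr (2 ^- _); have := pn i; lia.
apply: (val_gt_twist_factor hv); first exact: (chi_val_ge hv hchi).
by have hp := p2 i; rewrite -modzMm he; have -> : ((p i)%:Z %% 2)%Z = 1 by lia.
Qed.

(** This is where n >= f_p + 2 is used: chi(p) has order at least 4. *)
Lemma euler_val_half i : euler_val i <= 2^-1.
Proof.
rewrite /euler_val; have -> : (n.-1 - f2 (p i) = (n.-2 - f2 (p i)).+1)%N by have := pn i; lia.
rewrite exprS invfM ler_piMr ?invr_ge0 // invf_le1 ?exprn_gt0 // exprn_ege1 // ler1n //.
Qed.

Lemma lead_term_val T : val_eq v (expected_val T) (lead_term T).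
Proof.
apply: (val_eqM hv); first exact: (val_eq_Lval_chi hv hchi).
pose e i := 1 - chi (p i)%:Z.
have [//|hp _] := @same_lead_prod _ _ hv _ T euler_val e e; last exact: hp.
move=> i iT; apply: (same_lead_refl hv); exact: (val_eq_one_sub hv (chi_prime i)).
Qed.

Lemma mixed_char_odd T i : i \notin T -> (mixed_char T set0 (p i)%:Z %% 2)%Z = 1.
Proof.
move=> iT; rewrite /mixed_char; elim/big_ind: _ => //; first exact: odd_mulz.
move=> j _; rewrite /mixed_factor in_set0 mulr1; case: ifP => // jT.
have : ~~ (p j %| (p i)%:Z)%Z.
  rewrite -[(_ %| _)%Z]/(p j %| p i)%N dvdn_prime2 //; apply/eqP => /pinj e.
  by move: iT; rewrite -e jT.
by move=> /(psi_prime_val (pp j)) /orP[] /eqP ->.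
Qed.

(** On integers prime to d, the indicator of the m with psi_p(m) = 1 for all p in T. *)
Definition residue_indicator (T : {set I}) (a : int) : int :=
  \prod_(i in T) ((psi_prime (p i) a + (~~ (p i %| a)%Z)%:R) %/ 2)%Z.

(** Expand the product over T of psi_p + 1_p, whose factors are 0 or 2. *)
Lemma sum_mixed_char T a :
  \sum_(U : {set I} | U \subset T) mixed_char U (T :\: U) a = 2 ^+ #|T| * residue_indicator T a.
Proof.
rewrite /residue_indicator -[RHS]/(2 ^+ #|T| * _).
have -> : 2 ^+ #|T| = \prod_(i in T) (2 : int) by rewrite prodr_const.
rewrite -big_split /=.
transitivity (\prod_i ((if i \in T then psi_prime (p i) a else 0) +
                       (if i \in T then (~~ (p i %| a)%Z)%:R else 1))).
  rewrite (bigA_distr 1 +%R) /= [RHS](bigID (fun U : {set I} => U \subset T)) /=.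
  rewrite [X in _ = _ + X]big1 ?addr0; last first.
    move=> U /subsetPn[i iU iT]; apply/eqP/prodf_eq0; exists i => //.
    by rewrite iU (negPf iT).
  apply: eq_bigr => U UT; apply: eq_bigr => i _; rewrite /mixed_factor inE.
  case iU : (i \in U); rewrite /= ?mulr1 ?mul1r //.
  by rewrite (fintype.subsetP UT _ iU).
rewrite [RHS]big_mkcond; apply: eq_bigr => i _; case: ifP => iT; last by rewrite add0r.
case: (boolP (p i %| a)%Z) => hp /=.
  by have := psi_prime_eq0 (pp i) a; rewrite hp => /eqP ->.
by have /orP[] := psi_prime_val (pp i) hp => /eqP ->.
Qed.

Lemma Lval_sum (F : nat) (J : Type) (s : seq J) (P : pred J) (h : J -> int -> int) :
  Lval F (twist chi (fun a => \sum_(j <- s | P j) h j a)) =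
  \sum_(j <- s | P j) Lval F (twist chi (h j)).
Proof.
rewrite /Lval -mulr_suml sumrN; congr (- _ / _); rewrite /second_moment exchange_big /=.
apply: eq_bigr => a _; rewrite -mulr_suml; congr (_ * _).
by rewrite /twist rmorph_sum /= mulr_sumr.
Qed.

Lemma Lval_scale (F : nat) (c : int) (h : int -> int) :
  Lval F (twist chi (fun a => c * h a)) = c%:~R * Lval F (twist chi h).
Proof.
rewrite /Lval mulrA mulrN; congr (- _ / _); rewrite /second_moment mulr_sumr.
by apply: eq_bigr => a _; rewrite /twist rmorphM /=; ring.
Qed.

Lemma residue_sum_val T : val_ge v (#|T|%:R + (1 - 2 ^- n.-1))
  (\sum_(U : {set I} | U \subset T) imprimitive_L U (T :\: U)).
Proof.
rewrite -Lval_sum (_ : (fun a => _) = fun a => 2 ^+ #|T| * residue_indicator T a); last first.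
  by apply/funext => a; exact: sum_mixed_char.
rewrite Lval_scale; apply: (val_geM hv).
  rewrite rmorphXn /=; elim: #|T| => [|m IH].
    by rewrite expr0; apply: val_eq_ge; exact: val_eq_one.
  rewrite exprS -add1n natrD; apply: (val_geM hv) => //.
  by apply: val_eq_ge; exact: val_eq_two.
apply: (val_ge_Lval hv hchi n2 d2).
- move=> a k; apply: eq_bigr => i iT; have /dvdnP[m ->] := pd i.
  have -> : 4 * (m * p i)%N%:Z * k = 4 * (p i)%:Z * (m%:Z * k) by rewrite PoszM; ring.
  by rewrite psi_primeD // dvdz_add_mul4.
- move=> a ha; apply: eq_bigr => i iT; rewrite psi_primeN //.
  by rewrite (_ : (p i %| - a)%Z = (p i %| a)%Z) // !dvdzE abszN.
Qed.

Lemma imprimitive_L_set0 : imprimitive_L set0 set0 = Lval (2 ^ (n + 2)) chi.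
Proof.
rewrite /imprimitive_L.
have -> : twist chi (mixed_char set0 set0) = chi.
  apply/funext => a; rewrite /twist /mixed_char big1 ?mulr1 // => i _.
  by rewrite /mixed_factor !in_set0 mulr1.
rewrite mulnC Lval_mul ?expn_gt0 //; last by case: (d) d2.
- exact: (chi_periodic hchi).
- exact: (chiN hchi).
- by rewrite (chi_even hchi).
have := @twist_sum _ _ _ hchi 1 (fun=> 1) n2 isT (fun _ _ => erefl).
by rewrite muln1 => h; rewrite -[RHS]h; apply: eq_bigr => a _; rewrite /twist mulr1.
Qed.

(** Solve the identity of [residue_sum_val] for the term U = T.  The other terms are
    congruent to [lead_term] T by induction, and their number is odd up to 2^|T|. *)
Theorem imprimitive_L_close T : val_gt v (expected_val T) (imprimitive_L T set0 - lead_term T).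
Proof.
move: {2}#|T| (leqnn #|T|) => m; elim: m T => [|m IH] T hT.
  move: hT; rewrite leqn0 cards_eq0 => /eqP ->.
  by rewrite imprimitive_L_set0 /lead_term big_set0 mulr1 subrr; apply: val_gt_zero.
have [->|T0] := eqVneq T set0; first by apply: IH; rewrite cards0.
have T1 : (0 < #|T|)%N by rewrite card_gt0.
have bound : expected_val T < #|T|%:R + (1 - 2 ^- n.-1).
  rewrite /expected_val addrC ltrD2r; apply: (@le_lt_trans _ _ (\sum_(i in T) 2^-1)).
    by apply: ler_sum => i _; exact: euler_val_half.
  rewrite sumr_const -[2^-1 *+ _]mulr_natl.
  have : 0 < #|T|%:R :> R by rewrite ltr0n.
  by move: (#|T|%:R : R) => t; lra.
(* B(T) is subtracted once for every subset of T, hence added back 2^|T| times *)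
have e : imprimitive_L T set0 - lead_term T =
   \sum_(U : {set I} | U \subset T) imprimitive_L U (T :\: U)
   - \sum_(U : {set I} | (U \subset T) && (U != T)) (imprimitive_L U (T :\: U) - lead_term T)
   - 2 ^+ #|T| * lead_term T.
  have -> : 2 ^+ #|T| * lead_term T = \sum_(U : {set I} | U \subset T) lead_term T.
    rewrite sumr_const -[lead_term T *+ _]mulr_natl; congr (_ * _).
    rewrite -[in LHS]natrX -card_powerset; congr (_%:R); apply: eq_card => U.
    by rewrite powersetE.
  rewrite (bigD1 T) //= setDv [X in _ - _ - X](bigD1 T) //= sumrB; ring.
rewrite e; apply: (val_gtD hv); first apply: (val_gtD hv).
- exact: val_ge_gt bound (residue_sum_val T).
- apply: (val_gtN hv); apply: (val_gt_sum hv) => U /andP[UT UnT].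
  have dis : [disjoint U & T :\: U] by rewrite -setI_eq0 setIDA setDIl setDv set0I.
  rewrite imprimitive_L_factor //.
  have -> : lead_term T = (\prod_(i in T :\: U) (1 - chi (p i)%:Z)) * lead_term U.
    rewrite /lead_term mulrCA; congr (_ * _).
    by rewrite [LHS](big_setID U) /= (setIidPr UT) mulrC.
  have -> : expected_val T = \sum_(i in T :\: U) euler_val i + expected_val U.
    by rewrite /expected_val [in LHS](big_setID U) /= (setIidPr UT); ring.
  apply: (same_leadM hv _ _).2.
    apply: (same_lead_prod hv) => i; rewrite inE => /andP[iU _].
    exact: lead_factor (mixed_char_odd iU).
  split; first exact: lead_term_val.
  apply: IH; rewrite -ltnS; apply: leq_trans hT; apply: proper_card.
  by rewrite properEneq UnT.
- apply: (val_gtN hv); apply: (@val_ge_gt _ _ (1 + expected_val T)); first by lra.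
  apply: (val_geM hv); last by apply: val_eq_ge; exact: lead_term_val.
  case: #|T| T1 => // k _; rewrite exprS -[1]addr0; apply: (val_geM hv).
    by apply: val_eq_ge; exact: val_eq_two.
  by rewrite -natrX; apply: (val_ge_int hv (2 ^ k)%N%:Z).
Qed.

Theorem imprimitive_L_val T : val_eq v (expected_val T) (imprimitive_L T set0).
Proof. exact: (val_eq_close hv (lead_term_val T) (imprimitive_L_close T)). Qed.

End SeveralPrimes.

(** * The valuation of L(chi psi_d, -1) *)

Theorem proposition4p3 (R : realType) (ord2 : R[i] -> \bar R)
    (hord2 : is_ord2 ord2)
    (d : nat) (hd2 : (2 <= d)%N) (hodd : odd d) (hsf : squarefree d)
    (n : nat) (hn : (n_bound d <= n)%N)
    (chi : int -> R[i]) (hchi : cyclotomic_Z2_character n chi)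
    (L : R[i] -> R[i])
    (hL : is_dirichlet_L (fun m : nat => chi m%:Z * (psi d m)%:~R) L) :
  is_algebraic (L (- 1)) /\
  ord2 (L (- 1)) =
    (1 + 2 ^ (1 - n%:Z) * (- 1 + \sum_(p <- primes d) 2 ^+ f2 p))%:E.
Proof.
have d0 : (0 < d)%N by lia.
have n2 : (2 <= n)%N by apply: leq_trans hn; rewrite /n_bound addn2.
pose p := tnth (in_tuple (primes d)).
have pin i : p i \in primes d by exact: mem_tnth.
have pp i : prime (p i) by have [] := odd_prime_dvd hodd (pin i).
have p2 i : odd (p i) by have [] := odd_prime_dvd hodd (pin i).
have pinj : injective p by apply/tuple_uniqP; exact: primes_uniq.
have pn i : (f2 (p i) + 2 <= n)%N.
  by apply: leq_trans hn; rewrite /n_bound leq_add2r; apply: leq_bigmax_seq.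
have dE : d = (\prod_i p i)%N by rewrite {1}(squarefree_prod d0 hsf) big_tnth.
set g := twist chi (mixed_char p setT set0).
have mcE a : mixed_char p setT set0 a = \prod_i psi_prime (p i) a.
  by apply: eq_bigr => i _; rewrite /mixed_factor in_setT in_set0 mulr1.
have hL' : is_dirichlet_L (fun m : nat => g m%:Z) L.
  suff <- : (fun m : nat => chi m%:Z * (psi d m)%:~R) = (fun m : nat => g m%:Z) by [].
  apply/funext => m; rewrite /g /twist; case: (boolP (odd m)) => hm; last first.
    by rewrite (chi_even hchi) ?mul0r //; lia.
  by rewrite mcE (psiE d0 hodd hsf (odd_gt0 hm) hm) big_tnth.
have hd i : (i \in [set: 'I_(size (primes d))]) || (i \in set0) -> (p i %| d)%N.
  by move=> _; have := pin i; rewrite mem_primes => /and3P[].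
have per := mixed_charD pp p2 hd.
have LE : L (- 1) = imprimitive_L n chi p setT set0.
  rewrite /imprimitive_L -dE; apply: dirichlet_L_value hL' _ _ _ _ _.
  - by rewrite muln_gt0 expn_gt0.
  - exact: (twist_periodic hchi per).
  - exact: (twistN hchi (mixed_charN pp p2 _ _)).
  - by rewrite /g /twist (chi_even hchi) ?mul0r.
  - exact: (twist_sum hchi n2 hodd per).
have [alg val] := imprimitive_L_val hord2 hchi n2 pp p2 pinj pn setT.
rewrite LE; split=> //; rewrite val; congr (_%:E).
have nE : n = n.-1.+1 by rewrite prednK // ltnW.
have e1 : 2 ^ (1 - n%:Z) = 2 ^- n.-1 :> R by rewrite {1}nE intS opprD addrA subrr sub0r -exprnN.
rewrite e1 mulrDr mulrN1 addrA /expected_val; congr (_ + _); rewrite [in RHS]big_tnth mulr_sumr.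
apply: eq_big => [i|i _]; first by rewrite in_setT.
have fN : (f2 (p i) <= n.-1)%N by have := pn i; lia.
by rewrite /euler_val -[in RHS](subnK fN) exprD invfM divfK // expf_neq0 // pnatr_eq0.
Qed.
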